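(* Let $Z\sim N(0,1)$ and let $\xi_1,\dots,\xi_m$ be i.i.d. with density function $h$, where $m=2k+1$ for some integer $k\ge1$. Assume that $\int_{-\infty}^0h(x)\,dx=\frac12$, $h(0)>0$, and $|h(x)-h(0)|\le C_0x^2$ for some constant $C_0$ and all $x$ in an open neighborhood of $0$. Let $\xi_{\mathrm{med}}$ be the sample median of $\xi_1,\dots,\xi_m$, with distribution function $G$ and density $g$. Then there are constants $C,\varepsilon>0$ depending on $h$ but not on $m$ such that the following hold. For $|x|\le\varepsilon$, $$g(x)=\frac{\sqrt{8k}\,h(0)}{\sqrt{2\pi}}\exp\big(-8kh^2(0)x^2/2+O(kx^4+k^{-1})\big),$$ and for $0<x<\varepsilon$, $$G(-x)=\Phi(-\sqrt{8k}\,h(0)x)\exp\big(O(kx^4+k^{-1})\big)\quad\text{and}\quad\overline G(x)=\overline\Phi(\sqrt{8k}\,h(0)x)\exp\big(O(kx^4+k^{-1})\big),$$ where $\overline G(x)=1-G(x)$ and $\overline\Phi(x)=1-\Phi(x)$. Consequently, for every $m$, there is a mapping $\widetilde\xi_{\mathrm{med}}(Z):\mathbb{R}\to\mathbb{R}$ such that $\mathcal{L}(\widetilde\xi_{\mathrm{med}}(Z))=\mathcal{L}(\xi_{\mathrm{med}})$ and $$|2h(0)\sqrt m\,\widetilde\xi_{\mathrm{med}}-Z|\le\frac Cm+\frac Cm|2h(0)\sqrt m\,\widetilde\xi_{\mathrm{med}}|^3\quad\text{when }|\widetilde\xi_{\mathrm{med}}|\le\varepsilon,$$ and $$|2h(0)\sqrt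 m\,\widetilde\xi_{\mathrm{med}}-Z|\le\frac Cm(1+|Z|^3)\quad\text{when }|Z|\le\varepsilon\sqrt m.$$
   Context: $\Phi$ is the standard normal distribution function and $\mathcal{L}(\cdot)$ denotes the law of a random variable. $O(u)$ denotes a quantity bounded in absolute value by $Cu$, with $C$ depending on $h$ only (not on $x$, $k$). The density of the median is taken as $g(x)=\frac{(2k+1)!}{(k!)^2}H^k(x)(1-H(x))^kh(x)$, where $H$ is the distribution function of $\xi_1$. *)

(* Defs.v *)
From HB Require Import structures.
From mathcomp Require Import all_boot all_order all_algebra.
From mathcomp Require Import all_classical all_reals all_analysis.
From mathcomp Require Import measurable_realfun.

Set Implicit Arguments.
Unset Strict Implicit.
Unset Printing Implicit Defensive.

Import Order.TTheory GRing.Theory Num.Theory.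
Import numFieldNormedType.Exports.

Local Open Scope classical_set_scope.
Local Open Scope ring_scope.

Definition is_density (R : realType) (h : R -> R) : Prop :=
  [/\ measurable_fun [set: R] h, forall x, 0 <= h x &
      (\int[lebesgue_measure]_x (h x)%:E = 1)%E].

(* Equality of laws is required on measurable sets only: the values of a
   measure on non-measurable sets are unspecified. *)
Definition eq_law d (T : measurableType d) (R : realType)
    (mu nu : set T -> \bar R) : Prop :=
  forall A : set T, measurable A -> mu A = nu A.

Definition has_density d (T : measurableType d) (R : realType)
    (P : probability T R) (X : {RV P >-> R}) (h : R -> R) : Prop :=
  eq_law (distribution P X)
    (fun A => \int[lebesgue_measure]_(x in A) (h x)%:E)%E.

Definition mutually_independent d (T : measurableType d) (R : realType)
    (P : probability T R) (I : finType) (X : I -> {RV P >-> R}) : Prop :=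
  forall (J : {set I}) (A : I -> set R), (forall i, measurable (A i)) ->
    (P (\bigcap_(i in [set i | i \in J]) (X i @^-1` A i)) =
     \prod_(i in J) P (X i @^-1` A i))%E.

Definition iid_density d (T : measurableType d) (R : realType)
    (P : probability T R) (I : finType) (X : I -> {RV P >-> R})
    (h : R -> R) : Prop :=
  mutually_independent X /\ forall i, has_density (X i) h.

(* normal_prob takes the mean and the standard deviation. *)
Definition is_std_normal d (T : measurableType d) (R : realType)
    (P : probability T R) (Z : {RV P >-> R}) : Prop :=
  eq_law (distribution P Z) (normal_prob 0 1).

Definition dist_fun d (T : measurableType d) (R : realType)
    (P : probability T R) (X : {RV P >-> R}) (x : R) : R :=
  fine (cdf X x).

Definition Phi (R : realType) (x : R) : R :=
  fine (normal_prob 0 1 `]-oo, x]).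

(* The order statistic of rank k + 1 among 2k + 1 values (nth counts from 0). *)
Definition median_fun d (T : measurableType d) (R : realType)
    (P : probability T R) (k : nat) (X : 'I_k.*2.+1 -> {RV P >-> R})
    (w : T) : R :=
  nth 0 (sort <=%R [seq X i w | i <- enum 'I_k.*2.+1]) k.

Lemma measurable_median_fun d (T : measurableType d) (R : realType)
    (P : probability T R) (k : nat) (X : 'I_k.*2.+1 -> {RV P >-> R}) :
  measurable_fun [set: T] (median_fun X).
Proof.
pose N (x : R) (w : T) : R :=
  \sum_(i <- enum 'I_k.*2.+1) \1_(X i @^-1` `]-oo, x]) w.
have mN x : measurable_fun [set: T] (N x).
  apply: measurable_sum => i; apply: measurable_indic.
  exact: measurable_funPTI.
apply: (measurability _ (RGenOInfty.measurableE R)) => // _ [_ [x ->] <-].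
suff -> : median_fun X @^-1` `]x, +oo[ = N x @^-1` `]-oo, k%:R].
  by apply: mN.
suff E w : (x < median_fun X w) = (N x w <= k%:R).
  by apply/seteqP; split=> w; rewrite /= !in_itv/= andbT E.
set s := [seq X i w | i <- enum 'I_k.*2.+1].
have -> : N x w = (count (<= x) s)%:R.
  rewrite count_map -sum1_count natr_sum big_mkcond /=; apply: eq_bigr => i _.
  rewrite indicE; case: ifPn => xi; first by rewrite mem_set//= in_itv.
  by rewrite memNset//= in_itv/=; exact/negP.
have ks : (k < size (sort <=%R s))%N.
  by rewrite size_sort size_map size_enum_ord ltnS -addnn leq_addr.
rewrite ler_nat -(count_sort <=%R); apply/idP/idP => [xk|sk].
  rewrite leqNgt; apply: contraTN xk => sk; rewrite -leNgt.
  by apply: nth_count_le => //; exact: sort_le_sorted.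
by apply: nth_count_gt; [exact: sort_le_sorted | rewrite sk ks].
Qed.

HB.instance Definition _ d (T : measurableType d) (R : realType)
    (P : probability T R) (k : nat) (X : 'I_k.*2.+1 -> {RV P >-> R}) :=
  isMeasurableFun.Build _ _ _ _ (median_fun X) (measurable_median_fun X).

Definition sample_median d (T : measurableType d) (R : realType)
    (P : probability T R) (k : nat) (X : 'I_k.*2.+1 -> {RV P >-> R}) :
  {RV P >-> R} := median_fun X.

(* H is meant to be the distribution function of the density h. *)
Definition median_pdf (R : realType) (k : nat) (H h : R -> R) (x : R) : R :=
  (k.*2.+1)`!%:R / (k`!%:R) ^+ 2 * H x ^+ k * (1 - H x) ^+ k * h x.

(* Main.v *)
Require Import Defs.
From HB Require Import structures.
From mathcomp Require Import all_boot all_order all_algebra.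
From mathcomp Require Import all_classical all_reals all_analysis.
From mathcomp Require Import measurable_realfun ring lra.

Set Implicit Arguments.
Unset Strict Implicit.
Unset Printing Implicit Defensive.

Import Order.TTheory GRing.Theory Num.Theory.
Import numFieldNormedType.Exports.

Local Open Scope classical_set_scope.
Local Open Scope ring_scope.

(** If H is the distribution function of the xi_i, the median of 2k+1 of them
    has distribution function G = B o H, where B is the distribution function
    of the Beta(k+1, k+1) law ([median_cdf k]).  Put T(t) = 1 - B(1/2 + t)
    ([median_tail]), a = sqrt (8 k) ([median_scale]), let phi be the Gaussian
    density and Q = 1 - Phi its tail.  Then
    T'(t) = - K a phi(a t) r(t), with a constant K ([median_ratio]) and
    r(t) = ((1 - 4 t^2) exp(4 t^2))^k ([median_defect]), which decreases from 1
    and is at least exp(- 32 k t^4) near 0.  Comparing derivatives gives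
      K exp(- g (k t^4 + 1 / (4 k))) Q(a t) <= T(t) <= min(1, K) Q(a t)
    for a large constant g, whence 1 <= K <= exp(g / (4 k)) at t = 0.
    The flatness of h at 0 gives H(x) = 1/2 + h(0) x + O(x^3), and Mills' ratio
    controls the effect of this cubic error on Q.
    The coupling is the quantile transform of Phi(Z): from Q(z) = T(t) and
    Mills' ratio one gets 0 <= z - a t <= C (1 + (a t)^3) / k. *)

(** * Monotonicity from the sign of a derivative *)

Section monotone_from_derivative.
Context {R : realType}.
Implicit Types (f df : R -> R) (a b : R).

Lemma is_derive_MVT f df a b :
  (forall x : R, a <= x <= b -> is_derive x 1 f (df x)) -> a < b ->
  exists2 c, a < c < b & f b - f a = df c * (b - a).
Proof.
move=> fdf ab.
have [x||c + E] := @MVT R f df a b ab; last by rewrite in_itv/=; exists c.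
  by rewrite in_itv/= => /andP[ax xb]; apply: fdf; rewrite !ltW.
by apply: derivable_within_continuous => x /[!in_itv]/= /fdf[].
Qed.

Lemma le0_is_derive_le f df a b :
  (forall x : R, a <= x <= b -> is_derive x 1 f (df x)) ->
  (forall x, a < x < b -> df x <= 0) -> a <= b -> f b <= f a.
Proof.
move=> fdf df0; rewrite le_eqVlt => /predU1P[->//|ab].
have [c /df0 dfc E] := is_derive_MVT fdf ab.
by rewrite -subr_le0 E mulr_le0_ge0// subr_ge0 ltW.
Qed.

Lemma ge0_is_derive_le f df a b :
  (forall x : R, a <= x <= b -> is_derive x 1 f (df x)) ->
  (forall x, a < x < b -> 0 <= df x) -> a <= b -> f a <= f b.
Proof.
move=> fdf df0; rewrite le_eqVlt => /predU1P[->//|ab].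
have [c /df0 dfc E] := is_derive_MVT fdf ab.
by rewrite -subr_ge0 E mulr_ge0// subr_ge0 ltW.
Qed.

End monotone_from_derivative.

(** * Differentiation rules and their automation *)

Section pointwise_derivatives.
Context {R : realType}.
Implicit Types (f g : R -> R) (x df dg : R).

(** These rules are phrased for explicit [fun y => ...] so that [derive_step] can match them against
    a function as it is written. *)
Lemma is_derive_fun_cst (c : R) x : is_derive x 1 (fun=> c) 0.
Proof. exact: is_derive_cst. Qed.

Lemma is_derive_fun_id x : is_derive x 1 (fun y : R => y) 1.
Proof. exact: is_derive_id. Qed.

Lemma is_derive_funD f g x df dg : is_derive x 1 f df -> is_derive x 1 g dg ->
  is_derive x 1 (fun y => f y + g y) (df + dg).
Proof. by move=> fx gx; exact: is_deriveD. Qed.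

Lemma is_derive_funN f x df : is_derive x 1 f df ->
  is_derive x 1 (fun y => - f y) (- df).
Proof. by move=> fx; exact: is_deriveN. Qed.

Lemma is_derive_funM f g x df dg : is_derive x 1 f df -> is_derive x 1 g dg ->
  is_derive x 1 (fun y => f y * g y) (f x * dg + g x * df).
Proof. by move=> fx gx; exact: is_deriveM. Qed.

Lemma is_derive_funX f n x df : is_derive x 1 f df ->
  is_derive x 1 (fun y => f y ^+ n) (n%:R * f x ^+ n.-1 * df).
Proof. by move=> fx; have := is_deriveX n fx; rewrite exprfctE. Qed.

Lemma is_derive_fun_comp f g x df dg :
  is_derive (g x) 1 f df -> is_derive x 1 g dg ->
  is_derive x 1 (fun y => f (g y)) (df * dg).
Proof. by move=> fx gx; have := is_derive1_comp fx gx. Qed.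

Lemma is_derive_fun_expR f x df : is_derive x 1 f df ->
  is_derive x 1 (fun y => expR (f y)) (expR (f x) * df).
Proof. by move=> fx; apply: is_derive_fun_comp. Qed.

End pointwise_derivatives.

(** Hypotheses come first: they supply the derivatives of non-elementary functions such as [Phi] or
    [median_tail]. *)
Ltac derive_step :=
  first
  [ eassumption
  | notypeclasses refine (is_derive_fun_cst _ _)
  | notypeclasses refine (is_derive_fun_id _)
  | notypeclasses refine (is_derive_funN _)
  | notypeclasses refine (is_derive_funD _ _)
  | notypeclasses refine (is_derive_fun_expR _)
  | notypeclasses refine (is_derive_funX _ _)
  | notypeclasses refine (is_derive_funM _ _) ].

(** The rules compute a derivative, and the remaining goal is its equality with the stated one,
    usually left to [ring] or [field]. *)
Ltac derive :=
  match goal with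
  | |- is_derive _ _ _ _ => notypeclasses refine (is_derive_eq _ _);
      [ repeat derive_step | rewrite /= ]
  end.

(** * The Gaussian tail *)

Section gaussian_tail.
Context {R : realType}.
Implicit Types x y q : R.

Definition gauss_pdf (x : R) : R := expR (- (x ^+ 2 / 2)) / Num.sqrt (2 * pi).

Definition gauss_tail (x : R) : R := 1 - Phi x.

Lemma sqrt2pi_gt0 : 0 < Num.sqrt (2 * pi) :> R.
Proof. by rewrite sqrtr_gt0 mulr_gt0// pi_gt0. Qed.

Lemma gauss_pdf_gt0 x : 0 < gauss_pdf x.
Proof. by rewrite divr_gt0 ?expR_gt0 ?sqrt2pi_gt0. Qed.

Lemma normal_pdf01 : normal_pdf 0 1 = gauss_pdf.
Proof.
rewrite normal_pdfE ?oner_neq0//; apply/funext => x.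
rewrite /normal_fun /normal_peak /gauss_pdf mulrC subr0 expr1n mul1r mulr_natl.
by rewrite mulNr.
Qed.

Lemma is_derive_Phi x : is_derive x 1 (@Phi R) (gauss_pdf x).
Proof.
have -> : @Phi R = fun y =>
    (\int[lebesgue_measure]_(t in [set` `]-oo, y]]) (gauss_pdf t))%R.
  by apply/funext => y; rewrite /Phi /normal_prob normal_pdf01.
(* The fundamental theorem of calculus needs [x] strictly inside the interval of integration; any
   point beyond [x] would do. *)
have x1 : x < x + 1 by rewrite ltrDl.
have [|||d E] := @continuous_FTC1 R gauss_pdf -oo%O x (x + 1) x1.
- rewrite -normal_pdf01; apply: (integrableS _ _ (@subsetT _ _)) => //.
  exact: integrable_normal_pdf.
- by rewrite ltNyr.
- by rewrite -normal_pdf01; apply: continuous_normal_pdf; rewrite oner_neq0.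
by split; [exact: d|rewrite -derive1E].
Qed.

Lemma is_derive_gauss_pdf x : is_derive x 1 gauss_pdf (- (x * gauss_pdf x)).
Proof.
have s0 := lt0r_neq0 sqrt2pi_gt0.
by rewrite /gauss_pdf; derive; field.
Qed.

Lemma is_derive_gauss_tail x : is_derive x 1 gauss_tail (- gauss_pdf x).
Proof.
have Px := is_derive_Phi x.
by rewrite /gauss_tail; derive; rewrite add0r.
Qed.

Lemma Phi_ge0 x : 0 <= Phi x.
Proof. by rewrite /Phi fine_ge0. Qed.

Lemma Phi_le1 x : Phi x <= 1.
Proof.
rewrite /Phi -[leRHS]/(fine 1%E) fine_le ?fin_num_measure//.
exact: probability_le1.
Qed.

Lemma gauss_tail_ge0 x : 0 <= gauss_tail x.
Proof. by rewrite subr_ge0 Phi_le1. Qed.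

(** The identity has distribution function [Phi] under the Gaussian law, so the limits of [Phi] at
    infinity are those of any cdf. *)
Let idRV : {RV (normal_prob 0 1 : probability (measurableTypeR R) R) >-> R} :=
  HB.pack (idfun : measurableTypeR R -> R)
    (isMeasurableFun.Build _ _ _ _ (idfun : measurableTypeR R -> R)
      (@measurable_id _ _ setT)).

Lemma cvg_Phi : Phi x @[x --> +oo] --> (1 : R).
Proof. exact: (fine_cvg (cvg_cdfy1 idRV)). Qed.

Lemma cvg_PhiN : Phi (- x) @[x --> +oo] --> (0 : R).
Proof.
have : Phi x @[x --> -oo] --> (0 : R) by exact: (fine_cvg (cvg_cdfNy0 idRV)).
by rewrite cvgNy_compNP.
Qed.

Lemma Phi_le_lim (C c q : R) : (forall y, q <= y -> C * Phi y <= c) -> C <= c.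
Proof.
move=> h; have hC : C * Phi y @[y --> +oo] --> C.
  by rewrite -[X in _ --> X]mulr1; apply: cvgMl_tmp; exact: cvg_Phi.
apply: (cvgr_to_le hC).
by apply: filterS (nbhs_pinfty_ge (num_real q)) => y; exact: h.
Qed.

(** The density is even, so [Phi y + Phi (- y)] has zero derivative; its limit at infinity
    identifies the constant as 1. *)
Lemma PhiN x : Phi (- x) = gauss_tail x.
Proof.
pose f y := Phi y + Phi (- y) : R.
have df (z : R) : is_derive z 1 f 0.
  have Pz := is_derive_Phi z.
  have PNz : is_derive z 1 (fun y => Phi (- y)) (gauss_pdf (- z) * -1).
    by notypeclasses refine (is_derive_fun_comp (is_derive_Phi _) _); derive.
  by rewrite /f; derive; rewrite /gauss_pdf sqrrN mulrN1 subrr.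
have fE : f = cst (f x) by apply/funext => y; exact: is_derive_0_is_cst.
have : f y @[y --> +oo] --> (1 + 0 : R).
  by apply: cvgD; [exact: cvg_Phi|exact: cvg_PhiN].
rewrite addr0 fE => f1.
have -> : gauss_tail x = f x - Phi x; last by rewrite /f addrC addKr.
congr (_ - _).
have f2 : (cst (f x) : R -> R) y @[y --> +oo] --> f x by exact: cvg_cst.
by rewrite (cvg_unique (@Rhausdorff R) f1 f2).
Qed.

Lemma gauss_tail0 : gauss_tail 0 = 2^-1.
Proof.
have := PhiN 0; rewrite oppr0 /gauss_tail; lra.
Qed.

Lemma gauss_tail_lt x y : x < y -> gauss_tail y < gauss_tail x.
Proof.
move=> xy; have [c _ E] := is_derive_MVT (fun z _ => is_derive_gauss_tail z) xy.
by rewrite -subr_lt0 E mulNr oppr_lt0 mulr_gt0 ?gauss_pdf_gt0 ?subr_gt0.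
Qed.

Lemma gauss_tail_le x y : x <= y -> gauss_tail y <= gauss_tail x.
Proof. by rewrite le_eqVlt => /predU1P[->//|/gauss_tail_lt/ltW]. Qed.

Lemma gauss_tail_gt0 x : 0 < gauss_tail x.
Proof.
by rewrite (le_lt_trans (gauss_tail_ge0 (x + 1)))// gauss_tail_lt// ltrDl.
Qed.

(* The sign of this derivative is constant for c = 1 and for c = 4 / 3, since
   3 / 4 * (1 + x) ^+ 2 <= x ^+ 2 + x + 1 <= (1 + x) ^+ 2 when 0 <= x. *)
Let is_derive_mills c x : 0 <= x ->
  is_derive x 1 (fun y => gauss_tail y - c * gauss_pdf y * (1 + y)^-1)
    (gauss_pdf x * (c * (x ^+ 2 + x + 1) / (1 + x) ^+ 2 - 1)).
Proof.
move=> x0; have Qx := is_derive_gauss_tail x; have px := is_derive_gauss_pdf x.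
have x1 : 1 + x != 0 by rewrite gt_eqF// ltr_wpDr.
have Vx : is_derive x 1 (fun y => (1 + y)^-1) (- (1 + x) ^- 2 * (0 + 1)).
  by apply: is_deriveV => //; repeat derive_step.
by derive; field.
Qed.

Lemma gauss_pdf_le1 x : gauss_pdf x <= 1.
Proof.
rewrite ler_pdivrMr ?sqrt2pi_gt0// mul1r (@le_trans _ _ 1)//.
  by rewrite expR_le1 oppr_le0 divr_ge0// sqr_ge0.
rewrite -[leLHS]sqrtr1 ler_wsqrtr//; have := @pi_ge2 R; lra.
Qed.

(** Lower Mills bound: for [c = 1] the function in [is_derive_mills] is nonincreasing and tends to
    0, hence is nonnegative. *)
Lemma gauss_pdf_le_tail q : 0 <= q -> gauss_pdf q <= (1 + q) * gauss_tail q.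
Proof.
move=> q0; have q1 : 0 < 1 + q by rewrite ltr_wpDr.
rewrite mulrC -ler_pdivrMr// -subr_ge0; apply/ler_addgt0Pr => e e0.
(* At this [y] the subtracted term is at most [1 / (1 + y)], hence at most [e]; this replaces a
   passage to the limit. *)
pose y := q + e^-1; have qy : q <= y by rewrite lerDl invr_ge0 ltW.
have y0 : 0 <= y := le_trans q0 qy.
have Fyq : gauss_tail y - 1 * gauss_pdf y * (1 + y)^-1 <=
    gauss_tail q - 1 * gauss_pdf q * (1 + q)^-1.
  apply: (le0_is_derive_le 
    (fun x qxy => is_derive_mills 1 (le_trans q0 (proj1 (andP qxy))))) => //.
  move=> x /andP[qx _]; have x0 : 0 < x by exact: le_lt_trans qx.
  by rewrite pmulr_rle0 ?gauss_pdf_gt0// subr_le0 ler_pdivrMr; nra.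
rewrite !mul1r in Fyq; rewrite -lerBlDr sub0r.
have ey : gauss_pdf y * (1 + y)^-1 <= e.
  rewrite ler_pdivrMr ?ltr_wpDr// (le_trans (gauss_pdf_le1 y))// -ler_pdivrMl// mulr1.
  by rewrite (le_trans _ (_ : y <= _)) ?lerDl// ?lerDr.
have := gauss_tail_ge0 y; lra.
Qed.

(** Upper Mills bound: for [c = 4 / 3] the same function is nondecreasing, so its value at [q] is at
    most [gauss_tail y] for every [y >= q], which tends to 0. *)
Lemma gauss_tail_le_pdf q : 0 <= q -> (1 + q) * gauss_tail q <= 4 / 3 * gauss_pdf q.
Proof.
move=> q0; have q1 : 0 < 1 + q by rewrite ltr_wpDr.
rewrite mulrC -ler_pdivlMr//.
suff : 1 <= 1 - (gauss_tail q - 4 / 3 * gauss_pdf q / (1 + q)) by lra.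
apply: (@Phi_le_lim _ _ q) => y qy.
have : gauss_tail q - 4 / 3 * gauss_pdf q * (1 + q)^-1 <=
    gauss_tail y - 4 / 3 * gauss_pdf y * (1 + y)^-1.
  apply: (ge0_is_derive_le 
    (fun x qxy => is_derive_mills (4 / 3) (le_trans q0 (proj1 (andP qxy))))) => //.
  move=> x /andP[qx _]; have x0 : 0 <= x by rewrite (le_trans q0)// ltW.
  rewrite pmulr_rge0 ?gauss_pdf_gt0// subr_ge0 ler_pdivlMr ?exprn_gt0 ?ltr_wpDr//.
  have := sqr_ge0 (x - 1); lra.
have : 0 <= 4 / 3 * gauss_pdf y * (1 + y)^-1.
  rewrite mulr_ge0// ?mulr_ge0// ?(ltW (gauss_pdf_gt0 _))// invr_ge0; lra.
by rewrite (_ : gauss_tail y = 1 - Phi y)//; lra.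
Qed.

(** Integrated form of Mills' bounds: the logarithmic derivative of the tail lies between
    [- (1 + y)], used here, and [- 3 / 4 * (1 + y)], used in the next lemma. *)
Lemma gauss_tail_expR_nondecreasing p q : 0 <= p -> p <= q ->
  gauss_tail p * expR (p + p ^+ 2 / 2) <= gauss_tail q * expR (q + q ^+ 2 / 2).
Proof.
move=> p0 pq; apply: (@ge0_is_derive_le R
  (fun y => gauss_tail y * expR (y + y ^+ 2 / 2))
  (fun y => expR (y + y ^+ 2 / 2) * ((1 + y) * gauss_tail y - gauss_pdf y))) => //.
- by move=> x _; have Qx := is_derive_gauss_tail x; derive; field.
- move=> x /andP[px _]; rewrite pmulr_rge0 ?expR_gt0// subr_ge0.
  by rewrite gauss_pdf_le_tail// (le_trans p0)// ltW.
Qed.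

Lemma gauss_tail_expR_nonincreasing p q : 0 <= p -> p <= q ->
  gauss_tail q * expR (3 / 4 * (q + q ^+ 2 / 2)) <=
  gauss_tail p * expR (3 / 4 * (p + p ^+ 2 / 2)).
Proof.
move=> p0 pq; apply: (@le0_is_derive_le R
  (fun y => gauss_tail y * expR (3 / 4 * (y + y ^+ 2 / 2)))
  (fun y => expR (3 / 4 * (y + y ^+ 2 / 2)) *
     (3 / 4 * ((1 + y) * gauss_tail y) - gauss_pdf y))) => //.
- by move=> x _; have Qx := is_derive_gauss_tail x; derive; field.
- move=> x /andP[px _]; rewrite pmulr_rle0 ?expR_gt0//.
  have /gauss_tail_le_pdf : 0 <= x by rewrite (le_trans p0)// ltW.
  lra.
Qed.

End gaussian_tail.

(** * The distribution function of the median of uniform variables *)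

Section beta_distribution_function.
Context {R : realType}.
Implicit Types (k n : nat) (u t : R).

(** Descending induction on [k], starting from the empty sum at [k = n]. The derivatives of
    consecutive terms telescope through the absorption identity [binE]. *)
Lemma is_derive_binomial_tail n k u : (k <= n)%N ->
  is_derive u 1
    (fun v : R => \sum_(k.+1 <= j < n.+1) 'C(n, j)%:R * v ^+ j * (1 - v) ^+ (n - j))
    ('C(n, k.+1)%:R * k.+1%:R * u ^+ k * (1 - u) ^+ (n - k.+1)).
Proof.
move=> kn; rewrite -(subKn kn); elim: (n - k)%N (leq_subr k n) => [_|d IH dn].
  rewrite subn0 bin_small// mul0r !mul0r.
  under eq_fun do rewrite big_geq//.
  exact: is_derive_fun_cst.
have dn' : (d <= n)%N by exact: ltnW.
have {IH} := IH dn'.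
have E : (n - d = (n - d.+1).+1)%N by rewrite subnSK.
rewrite E; have := leq_subr d.+1 n.
have dE : (n - (n - d.+1).+1 = d)%N by rewrite subnSK// subKn.
move: dE; set i := (n - d.+1)%N => dE iln IHd.
have id : (i < n)%N by rewrite /i -subSn// subSS leq_subr.
under eq_fun do rewrite big_ltn ?ltnS//.
derive.
have binE : 'C(n, i.+2)%:R * i.+2%:R = d%:R * 'C(n, i.+1)%:R :> R.
  by rewrite -!natrM mulnC mul_bin_left dE.
rewrite binE dE subnS dE; case: (d) => [|e]; rewrite !exprS/=; ring.
Qed.

(** The probability of at least [k + 1] successes in [2 k + 1] trials. This form of the Beta
    distribution function is the one produced by counting the samples below a level. *)
Definition median_cdf k u : R :=
  \sum_(k.+1 <= j < k.*2.+2) 'C(k.*2.+1, j)%:R * u ^+ j * (1 - u) ^+ (k.*2.+1 - j).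

(** The normalising constant of the Beta(k+1, k+1) density. *)
Definition median_cst k : R := (k.*2.+1)`!%:R / k`!%:R ^+ 2.

Lemma median_cst_gt0 k : 0 < median_cst k.
Proof. by rewrite divr_gt0 ?exprn_gt0// ltr0n fact_gt0. Qed.

Lemma is_derive_median_cdf k u :
  is_derive u 1 (median_cdf k) (median_cst k * (u * (1 - u)) ^+ k).
Proof.
have kk : (k.*2.+1 - k.+1 = k)%N by rewrite subSS -addnn addnK.
have k2 : (k.+1 <= k.*2.+1)%N by rewrite ltnS -addnn leq_addr.
have := is_derive_binomial_tail u (ltnW k2); rewrite kk => D.
apply: is_derive_eq D _; rewrite exprMn mulrA; congr (_ * _ * _).
rewrite /median_cst -(bin_fact k2) kk factS !natrM; field.
by rewrite ?pnatr_eq0 -?lt0n ?fact_gt0.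
Qed.

Lemma median_cdf0 k : median_cdf k 0 = 0.
Proof.
rewrite /median_cdf big_nat_cond big1// => j /andP[/andP[kj _] _].
by rewrite expr0n gtn_eqF ?(leq_trans _ kj)// mulr0 mul0r.
Qed.

Lemma median_cdf1 k : median_cdf k 1 = 1.
Proof.
rewrite /median_cdf big_nat_recr/=; last by rewrite ltnS -addnn leq_addr.
rewrite big_nat_cond big1 ?add0r; first by rewrite binn subnn expr0 expr1n !mulr1.
move=> j /andP[/andP[_ jk] _].
by rewrite subrr expr0n gtn_eqF ?subn_gt0// mulr0.
Qed.

(** The density is symmetric about 1/2, so the sum of both values is constant, and it is 1 at 0. *)
Lemma median_cdf_onem k u : median_cdf k (1 - u) = 1 - median_cdf k u.
Proof.
suff /(_ u) : forall v, median_cdf k v + median_cdf k (1 - v) = 1 by lra.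
move=> v; pose f w := median_cdf k w + median_cdf k (1 - w).
have df (w : R) : is_derive w 1 f 0.
  have D1 := is_derive_median_cdf k w.
  have D2 : is_derive w 1 (fun y => median_cdf k (1 - y))
      (median_cst k * ((1 - w) * (1 - (1 - w))) ^+ k * (0 - 1)).
    by notypeclasses refine (is_derive_fun_comp (is_derive_median_cdf _ _) _); derive.
  by rewrite /f; derive; rewrite subKr (mulrC (1 - w)); ring.
rewrite -/(f v) (is_derive_0_is_cst v 0 df) /f subr0 median_cdf0 median_cdf1 add0r//.
Qed.

(** Only the last term of the binomial sum is kept. *)
Lemma median_cdf_ge_expr k u : 0 <= u <= 1 -> u ^+ k.*2.+1 <= median_cdf k u.
Proof.
move=> /andP[u0 u1].
rewrite /median_cdf big_nat_recr/=; last by rewrite ltnS -addnn leq_addr.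
rewrite binn subnn expr0 mul1r mulr1 lerDr big_nat_cond sumr_ge0// => j _.
by rewrite !mulr_ge0// exprn_ge0// subr_ge0.
Qed.

End beta_distribution_function.

(** * Comparison of the median tail with the Gaussian tail *)

Section median_tail.
Context {R : realType}.
Implicit Types (k : nat) (s t : R).

Lemma onem_expR_le1 s : (1 - s) * expR s <= 1.
Proof.
have := expR_ge1Dx (- s); rewrite expRN => h.
by rewrite -ler_pdivlMr ?expR_gt0// div1r.
Qed.

Lemma onem_expR_nonincreasing s t : 0 <= s -> s <= t ->
  (1 - t) * expR t <= (1 - s) * expR s.
Proof.
move=> s0 st; apply: (@le0_is_derive_le R (fun y => (1 - y) * expR y)
  (fun y => - (y * expR y))) => //.
- by move=> x _; derive; ring.
- move=> x /andP[sx _]; rewrite oppr_le0 mulr_ge0 ?expR_ge0//.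
  by rewrite (le_trans s0)// ltW.
Qed.

(** After division by [expR s] and [1 + x <= expR x], this is [1 <= (1 - s) * (1 + s + 2 * s ^+ 2)],
    whose right side is [1 + s ^+ 2 * (1 - 2 * s)]. *)
Lemma expR_le_onem_expR s : 0 <= s <= 2^-1 ->
  expR (- (2 * s ^+ 2)) <= (1 - s) * expR s.
Proof.
move=> /andP[s0 s1].
have -> : - (2 * s ^+ 2) = s - (s + 2 * s ^+ 2) by ring.
rewrite expRD mulrC ler_pM2r ?expR_gt0// expRN.
have h := expR_ge1Dx (s + 2 * s ^+ 2).
rewrite -[leLHS]mul1r ler_pdivrMr ?expR_gt0//.
apply: le_trans (ler_wpM2l _ h); nra.
Qed.

Definition median_scale k : R := Num.sqrt (8 * k%:R).
Definition median_tail k t : R := median_cdf k (2^-1 - t).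
(** The Beta density at 1/2 divided by the peak [a / sqrt (2 * pi)] of the centred Gaussian density
    with standard deviation [1 / a]. *)
Definition median_ratio k : R :=
  median_cst k / 4 ^+ k * Num.sqrt (2 * pi) / median_scale k.

Local Notation a := median_scale.
Local Notation T := median_tail.
Local Notation K := median_ratio.

Definition median_defect k t : R := ((1 - 4 * t ^+ 2) * expR (4 * t ^+ 2)) ^+ k.
Local Notation r := median_defect.

Lemma median_scale_gt0 k : (0 < k)%N -> 0 < a k.
Proof. by move=> k0; rewrite sqrtr_gt0 mulr_gt0// ltr0n. Qed.

Lemma sqr_median_scale k : a k ^+ 2 = 8 * k%:R.
Proof. by rewrite sqr_sqrtr// mulr_ge0. Qed.

Lemma median_ratio_gt0 k : (0 < k)%N -> 0 < K k.
Proof.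
move=> k0; rewrite divr_gt0 ?median_scale_gt0// mulr_gt0 ?sqrt2pi_gt0//.
by rewrite divr_gt0 ?median_cst_gt0// exprn_gt0.
Qed.

Lemma median_densityE k t : (0 < k)%N ->
  median_cst k * ((2^-1 - t) * (2^-1 + t)) ^+ k =
  K k * a k * gauss_pdf (a k * t) * r k t.
Proof.
move=> k0; rewrite /median_defect (exprMn _ (1 - 4 * t ^+ 2)) -expRM_natl /K /gauss_pdf.
rewrite (exprMn _ (a k)) sqr_median_scale.
have -> : (2^-1 - t) * (2^-1 + t) = (1 - 4 * t ^+ 2) / 4 by field.
rewrite expr_div_n.
have -> : 8 * k%:R * t ^+ 2 / 2 = k%:R * (4 * t ^+ 2) by field.
rewrite expRN; field.
by rewrite !gt_eqF ?expR_gt0 ?sqrt2pi_gt0 ?median_scale_gt0//.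
Qed.

Lemma is_derive_median_tail k t : (0 < k)%N ->
  is_derive t 1 (T k) (- (K k * a k * gauss_pdf (a k * t) * r k t)).
Proof.
move=> k0; rewrite -median_densityE//.
have : is_derive t 1 (T k) (median_cst k * ((2^-1 - t) * (1 - (2^-1 - t))) ^+ k * (0 -
    1)).
  by notypeclasses refine (is_derive_fun_comp (is_derive_median_cdf _ _) _); derive.
by move=> D; apply: is_derive_eq D _; rewrite (_ : 1 - (2^-1 - t) = 2^-1 + t) ?sub0r
    ?mulrN1//; field.
Qed.

Let is_derive_tail_scaled k t :
  is_derive t 1 (fun y => gauss_tail (a k * y)) (- (a k * gauss_pdf (a k * t))).
Proof.
have : is_derive t 1 (fun y => gauss_tail (a k * y)) (- gauss_pdf (a k * t) * (a k * 1 +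
    t * 0)).
  by notypeclasses refine (is_derive_fun_comp (is_derive_gauss_tail _) _); derive.
by move=> D; apply: is_derive_eq D _; ring.
Qed.

Lemma median_defect_le1 k t : `|t| <= 2^-1 -> r k t <= 1.
Proof.
move=> t1; rewrite /median_defect exprn_ile1//; last exact: onem_expR_le1.
rewrite mulr_ge0 ?expR_ge0// subr_ge0 -(real_normK (num_real t)); have := normr_ge0 t;
    nra.
Qed.

Lemma median_defect_ge k t : `|t| <= 4^-1 -> expR (- (32 * k%:R * t ^+ 4)) <= r k t.
Proof.
move=> t1; have -> : - (32 * k%:R * t ^+ 4) = k%:R * (- (2 * (4 * t ^+ 2) ^+ 2)).
  by ring.
rewrite expRM_natl lerXn2r ?nnegrE ?expR_ge0//.
  rewrite mulr_ge0 ?expR_ge0// subr_ge0 -(real_normK (num_real t)); have := normr_ge0 t;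
      nra.
apply: expR_le_onem_expR; rewrite -(real_normK (num_real t)); have := normr_ge0 t; nra.
Qed.

Lemma median_defect_nonincreasing k s t : 0 <= s -> s <= t -> t <= 2^-1 -> r k t <= r k s.
Proof.
move=> s0 st t1.
have pos (x : R) : 0 <= x <= 2^-1 -> 0 <= (1 - 4 * x ^+ 2) * expR (4 * x ^+ 2).
  move=> /andP[x0 x1]; rewrite mulr_ge0 ?expR_ge0// subr_ge0; nra.
rewrite lerXn2r ?nnegrE ?pos//; [lra|lra|].
apply: onem_expR_nonincreasing; first by rewrite mulr_ge0// sqr_ge0.
by rewrite ler_pM2l// lerXn2r// nnegrE; lra.
Qed.

Lemma median_tail0 k : T k 0 = 2^-1.
Proof.
rewrite /T subr0; have := @median_cdf_onem R k 2^-1.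
have -> : 1 - 2^-1 = 2^-1 :> R by field.
lra.
Qed.

Lemma median_tail_half k : T k 2^-1 = 0.
Proof. by rewrite /T subrr median_cdf0. Qed.

Let is_derive_diff c k t : (0 < k)%N ->
  is_derive t 1 (fun y => c * gauss_tail (a k * y) - T k y)
    (a k * gauss_pdf (a k * t) * (K k * r k t - c)).
Proof.
move=> k0; have D1 := is_derive_tail_scaled k t.
have D2 := is_derive_median_tail t k0.
by derive; ring.
Qed.

(** The difference [K Q(a t) - T(t)] is nonincreasing because [r <= 1], and it is nonnegative at
    1/2, where [T] vanishes. *)
Lemma median_tail_le_ratio k t : (0 < k)%N -> 0 <= t <= 2^-1 ->
  T k t <= K k * gauss_tail (a k * t).
Proof.
move=> k0 /andP[t0 t1]; have K0 := median_ratio_gt0 k0; have a0 := median_scale_gt0 k0.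
rewrite -subr_ge0; apply: le_trans (le0_is_derive_le
  (fun x _ => @is_derive_diff (K k) k x k0) _ t1).
  by rewrite median_tail_half subr0 mulr_ge0 ?gauss_tail_ge0// ltW.
move=> x /andP[tx x1].
rewrite mulr_ge0_le0 ?mulr_ge0 ?(ltW a0) ?(ltW (gauss_pdf_gt0 _))//.
rewrite subr_le0 ger_pMr// median_defect_le1// ger0_norm ?(le_trans t0)// ltW//.
Qed.

Lemma median_ratio_ge1 k : (0 < k)%N -> 1 <= K k.
Proof.
move=> k0; have := @median_tail_le_ratio k 0 k0.
rewrite median_tail0 mulr0 gauss_tail0; lra.
Qed.

(* The derivative of Q(a t) - T(t) changes sign once, from + to -, so this
   difference is minimal at an endpoint. *)
Lemma median_tail_le k t : (0 < k)%N -> 0 <= t <= 2^-1 ->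
  T k t <= gauss_tail (a k * t).
Proof.
move=> k0 /andP[t0 t1]; have K0 := median_ratio_gt0 k0; have a0 := median_scale_gt0 k0.
rewrite -subr_ge0 -[X in X - _]mul1r; have [Kr|Kr] := leP 1 (K k * r k t).
  apply: le_trans (ge0_is_derive_le
    (fun x _ => @is_derive_diff 1 k x k0) _ t0).
    by rewrite mulr0 gauss_tail0 median_tail0 mul1r subrr.
  move=> x /andP[x0 xt].
  rewrite mulr_ge0 ?mulr_ge0 ?(ltW a0) ?(ltW (gauss_pdf_gt0 _))//.
  rewrite subr_ge0 (le_trans Kr)// ler_pM2l// median_defect_nonincreasing// ltW//.
apply: le_trans (le0_is_derive_le
  (fun x _ => @is_derive_diff 1 k x k0) _ t1).
  by rewrite median_tail_half subr0 mul1r gauss_tail_ge0.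
move=> x /andP[tx x1].
rewrite mulr_ge0_le0 ?mulr_ge0 ?(ltW a0) ?(ltW (gauss_pdf_gt0 _))//.
rewrite subr_le0 (le_trans _ (ltW Kr))// ler_pM2l// median_defect_nonincreasing// ltW//.
Qed.


(** A crude bound from ['C(2 k, k) <= 4 ^ k] and [2 * pi <= 8]. It only has to lose against the
    exponential gain at [t = 1 / 4]. *)
Lemma median_ratio_le k : (0 < k)%N -> K k <= k.*2.+1%:R.
Proof.
move=> k0; have k1 : 1 <= k%:R :> R by rewrite ler1n.
have c_le : median_cst k <= k.*2.+1%:R * 4 ^+ k :> R.
  have bin4 : ('C(k.*2, k) <= 4 ^ k)%N.
    rewrite (_ : 4 ^ k = (1 + 1) ^ k.*2)%N; last by rewrite addn1 -mul2n expnM.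
    rewrite expnDn (bigD1 (inord k))//= inordK ?ltnS -?addnn ?leq_addr//.
    by rewrite !exp1n !muln1 addnn leq_addr.
  have k2 : (k <= k.*2)%N by rewrite -addnn leq_addr.
  rewrite /median_cst ler_pdivrMr ?exprn_gt0 ?ltr0n ?fact_gt0//.
  rewrite -!(natrX, natrM) ler_nat factS -(bin_fact k2) -addnn addnK mulnn.
  by rewrite mulnA leq_mul// leq_mul// addnn.
have s_le : Num.sqrt (2 * pi) <= median_scale k.
  by rewrite ler_wsqrtr//; have := @pihalf_lt2 R; lra.
rewrite /K -mulrA -[leRHS]mulr1; apply: ler_pM.
- by rewrite divr_ge0 ?exprn_ge0// ltW// median_cst_gt0.
- by rewrite divr_ge0 ?sqrtr_ge0.
- by rewrite ler_pdivrMr// exprn_gt0.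
- by rewrite ler_pdivrMr ?mul1r// median_scale_gt0.
Qed.

(* At t = 1 / 4 the factor w below is then at most exp (- 8 k), which beats the
   trivial bound (1 / 4) ^+ (2 k + 1) <= T k (1 / 4). *)
Variable g : R.
Hypothesis g_ge : 2 ^+ 11 <= g.

Let g_ge64 : 64 <= g.
Proof. by apply: le_trans g_ge; lra. Qed.

Let g_ge0 : 0 <= g.
Proof. by move: g_ge64; lra. Qed.

Let w k t : R := expR (- (g * (k%:R * t ^+ 4) + g / 4 / k%:R)).

Let is_derive_w k t : is_derive t 1 (w k) (- (4 * g * k%:R * t ^+ 3) * w k t).
Proof. by rewrite /w; derive; ring. Qed.

Let is_derive_wdiff k t : (0 < k)%N ->
  is_derive t 1 (fun y => T k y - K k * w k y * gauss_tail (a k * y))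
   (K k * (w k t * (a k * gauss_pdf (a k * t)
                    + 4 * g * k%:R * t ^+ 3 * gauss_tail (a k * t))
     - a k * gauss_pdf (a k * t) * r k t)).
Proof.
move=> k0; have D1 := is_derive_tail_scaled k t; have D3 := is_derive_w k t.
have D2 := is_derive_median_tail t k0.
by derive; ring.
Qed.

Let w_end k : (0 < k)%N ->
  K k * w k 4^-1 * gauss_tail (a k * 4^-1) <= T k 4^-1.
Proof.
move=> k0; have k1 : 1 <= k%:R :> R by rewrite ler1n.
have T_ge : 4^-1 ^+ k.*2.+1 <= T k 4^-1.
  have -> : T k 4^-1 = median_cdf k 4^-1 by rewrite /T; congr median_cdf; field.
  by apply: median_cdf_ge_expr; lra.
apply: le_trans T_ge.
have e2 : 4 <= expR 2 :> R.
  rewrite -[X in expR X]/(1 + 1) expRD; have := expR_ge1Dx (1 : R); nra.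
have Ke : K k <= expR (2 * k%:R).
  apply: le_trans (median_ratio_le k0) (le_trans _ (expR_ge1Dx _)).
  by rewrite -addn1 natrD -mul2n natrM addrC.
have we : w k 4^-1 <= expR (- (8 * k%:R)).
  rewrite ler_expR lerN2; apply: (@le_trans _ _ (g * (k%:R * 4^-1 ^+ 4))).
    have -> : 4^-1 ^+ 4 = 256^-1 :> R by field.
    have -> : 8 * k%:R = 2 ^+ 11 * (k%:R * 256^-1) :> R by field.
    exact: (ler_wpM2r (divr_ge0 (ler0n _ _) (ler0n _ _)) g_ge).
  by rewrite lerDl !divr_ge0 ?ler0n ?g_ge0.
have Q1 : gauss_tail (a k * 4^-1) <= 1 by rewrite gerBl Phi_ge0.
(* The product is at most [expR (- 6 k)], hence at most [4 ^ (- 3 k)] since [expR 2 >= 4]; and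
   [2 k + 1 <= 3 k] because [k >= 1]. *)
apply: (@le_trans _ _ (expR (2 * k%:R) * expR (- (8 * k%:R)) * 1)).
  have K0 := ltW (median_ratio_gt0 k0).
  by apply: ler_pM => //; [rewrite mulr_ge0 ?expR_ge0|exact: gauss_tail_ge0|
    apply: ler_pM => //; exact: expR_ge0].
rewrite mulr1 -expRD (_ : 2 * k%:R + - (8 * k%:R) = - (k.*2 + k)%:R * 2); last first.
  by rewrite natrD -mul2n natrM; ring.
rewrite mulNr expRN expRM_natl exprVn lef_pV2 ?posrE ?exprn_gt0 ?expR_gt0//.
apply: (@le_trans _ _ (4 ^+ (k.*2 + k))).
  by rewrite ler_weXn2l ?ler1n// -[k.*2.+1]addn1 leq_add2l.
by rewrite lerXn2r// nnegrE ?expR_ge0.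
Qed.

(* The factor w(t) = exp(- g (k t^4 + 1 / (4 k))) with g large
   makes T - K w Q(a t) nonincreasing: by Mills' bound, differentiating w costs
   a factor 1 + O(t^2), which is absorbed by AM-GM. *)
Lemma median_tail_ge k t : (0 < k)%N -> 0 <= t <= 4^-1 ->
  K k * w k t * gauss_tail (a k * t) <= T k t.
Proof.
move=> k0 /andP[t0 t1]; have K0 := median_ratio_gt0 k0; have a0 := median_scale_gt0 k0.
have k0' : 0 < k%:R :> R by rewrite ltr0n.
rewrite -subr_ge0; apply: le_trans (le0_is_derive_le
  (fun x _ => @is_derive_wdiff k x k0) _ t1).
  by rewrite subr_ge0 w_end.
move=> x /andP[tx x1]; have x0 : 0 < x by exact: le_lt_trans tx.
rewrite pmulr_rle0// subr_le0.
have p0 := gauss_pdf_gt0 (a k * x).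
have aQ : a k * x * gauss_tail (a k * x) <= 4 / 3 * gauss_pdf (a k * x).
  apply: le_trans (gauss_tail_le_pdf _); last by rewrite mulr_ge0 ?(ltW a0) ?(ltW x0).
  by rewrite ler_wpM2r ?gauss_tail_ge0// lerDr.
(* Trading [8 k] for [a ^+ 2] exposes the product [a x Q(a x)], which Mills' bound controls by the
   density. *)
have -> : 4 * g * k%:R * x ^+ 3 * gauss_tail (a k * x) =
    g / 2 * a k * x ^+ 2 * (a k * x * gauss_tail (a k * x)).
  transitivity (g / 2 * (8 * k%:R) * x ^+ 3 * gauss_tail (a k * x)); first by field.
  by rewrite -sqr_median_scale; ring.
apply: (@le_trans _ _ (a k * gauss_pdf (a k * x) *
    (w k x * (1 + 2 / 3 * g * x ^+ 2)))).
  have -> : a k * gauss_pdf (a k * x) * (w k x * (1 + 2 / 3 * g * x ^+ 2)) =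
      w k x * (a k * gauss_pdf (a k * x) +
               g / 2 * a k * x ^+ 2 * (4 / 3 * gauss_pdf (a k * x))) by field.
  apply: ler_wpM2l; first exact: expR_ge0.
  rewrite lerD2l; apply: ler_wpM2l aQ.
  by rewrite !mulr_ge0 ?sqr_ge0 ?(ltW a0) ?invr_ge0// ltW.
rewrite ler_wpM2l ?mulr_ge0 ?(ltW a0) ?(ltW p0)//.
apply: le_trans (median_defect_ge _ _); last by rewrite gtr0_norm// ltW.
apply: (@le_trans _ _ (w k x * expR (2 / 3 * g * x ^+ 2))).
  by rewrite ler_wpM2l ?expR_ge0 ?expR_ge1Dx.
rewrite -expRD ler_expR.
(* In terms of [y] the exponents compare as [32 y^2 <= g (y^2 + 1/4 - 2 y / 3)]. Completing the
   square leaves [5/9 g y^2] on the right, and [g >= 64] suffices. *)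
pose y := k%:R * x ^+ 2.
have -> : g * (k%:R * x ^+ 4) = g * y ^+ 2 / k%:R.
  by rewrite /y; field; rewrite gt_eqF.
have -> : 32 * k%:R * x ^+ 4 = 32 * y ^+ 2 / k%:R.
  by rewrite /y; field; rewrite gt_eqF.
have -> : 2 / 3 * g * x ^+ 2 = 2 / 3 * g * y / k%:R.
  by rewrite /y; field; rewrite gt_eqF.
rewrite -mulrDl -!mulNr -mulrDl ler_pM2r ?invr_gt0//.
have : 5 / 9 * y ^+ 2 <= y ^+ 2 + 4^-1 - 2 / 3 * y.
  by have := sqr_ge0 (2 / 3 * y - 2^-1); lra.
have := sqr_ge0 y; move: g_ge64; nra.
Qed.

Lemma median_ratio_le_expR k : (0 < k)%N -> K k <= expR (g / 4 / k%:R).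
Proof.
move=> k0; have := @median_tail_ge k 0 k0; rewrite median_tail0 mulr0 gauss_tail0.
rewrite /w expr0n/= !mulr0 add0r expRN lexx invr_ge0 => /(_ (ler0n _ _)).
by rewrite ger_pMl// ler_pdivrMr ?expR_gt0// mul1r.
Qed.

End median_tail.

(** * Expansions at a point where the density is flat *)

Section local_expansion.
Context {R : realType}.
Implicit Types (k : nat) (x y z s t b c : R).

Local Notation a := (@median_scale R).
Local Notation T := median_tail.

(** Converts two-sided multiplicative bounds into an error inside the exponential, with
    [theta = ln (x / y)]. *)
Lemma expR_sandwich x y b : 0 < y -> y * expR (- b) <= x -> x <= y * expR b ->
  exists2 theta, `|theta| <= b & x = y * expR theta.
Proof.
move=> y0 yx xy; have x0 : 0 < x by rewrite (lt_le_trans _ yx)// mulr_gt0 ?expR_gt0.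
have xy0 : 0 < x / y by rewrite divr_gt0.
exists (ln (x / y)); last by rewrite lnK ?posrE// mulrC divfK// gt_eqF.
rewrite ler_norml; apply/andP; split.
  by rewrite -[leLHS]expRK ler_ln ?posrE ?expR_gt0// ler_pdivlMr// mulrC.
by rewrite -[leRHS]expRK ler_ln ?posrE ?expR_gt0// ler_pdivrMr// mulrC.
Qed.

(** The exponents in [gauss_tail_expR_nondecreasing] differ by exactly
    [(q - p) * (1 + (p + q) / 2)]; the bound is symmetric, so [p <= q] may be assumed. *)
Lemma gauss_tail_shift p q : 0 <= p -> 0 <= q ->
  exists2 theta, `|theta| <= `|q - p| * (1 + (p + q) / 2) &
    gauss_tail p = gauss_tail q * expR theta :> R.
Proof.
wlog pq : p q / p <= q => [hw p0 q0|p0 q0].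
  have [/hw|/ltW/hw] := leP p q; first exact.
  move=> /(_ q0 p0)[th th_le E]; exists (- th).
    by rewrite normrN distrC (addrC p q).
  by rewrite E -mulrA -expRD subrr expR0 mulr1.
have qp0 : 0 <= q - p by rewrite subr_ge0.
have e0 : 0 <= `|q - p| * (1 + (p + q) / 2).
  by rewrite mulr_ge0//; lra.
apply: expR_sandwich; first exact: gauss_tail_gt0.
  rewrite (le_trans _ (gauss_tail_le pq))// ger_pMr ?gauss_tail_gt0//.
  by rewrite expR_le1 oppr_le0.
have := gauss_tail_expR_nondecreasing p0 pq.
rewrite -ler_pdivlMr ?expR_gt0// -[_ / expR _]mulrA -expRN -expRD ger0_norm//.
have -> : (q - p) * (1 + (p + q) / 2) = q + q ^+ 2 / 2 - (p + p ^+ 2 / 2) by field.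
by [].
Qed.

Variable g : R.
Hypothesis g_ge : 2 ^+ 11 <= g.

Let g_ge0 : 0 <= g.
Proof. by apply: le_trans g_ge; exact: exprn_ge0. Qed.

Lemma median_tail_expR k t : (0 < k)%N -> 0 <= t <= 4^-1 ->
  exists2 theta, `|theta| <= g * (k%:R * t ^+ 4 + k%:R^-1) &
    T k t = gauss_tail (a k * t) * expR theta.
Proof.
move=> k0 t01; have := t01 => /andP[t0 t1].
have ki0 : 0 <= k%:R^-1 :> R by rewrite invr_ge0.
apply: expR_sandwich; first exact: gauss_tail_gt0.
  apply: le_trans (median_tail_ge g_ge k0 t01).
  rewrite mulrC; apply: ler_wpM2r; first exact: gauss_tail_ge0.
  apply: (@le_trans _ _ (1 * expR (- (g * (k%:R * t ^+ 4) + g / 4 / k%:R)))).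
    rewrite mul1r ler_expR lerN2 mulrDr lerD2l -mulrA ler_wpM2l//.
    by rewrite ler_piMl//; lra.
  by apply: ler_wpM2r; [exact: expR_ge0|exact: median_ratio_ge1].
apply: le_trans (median_tail_le k0 _) _; first by apply/andP; split => //; lra.
apply: ler_peMr; first exact: gauss_tail_ge0.
by rewrite -expR0 ler_expR mulr_ge0// addr_ge0// mulr_ge0 ?exprn_ge0.
Qed.

(** AM-GM; it absorbs the relative error of [h x] against [h 0] into the admissible error. *)
Lemma sqr_le_quartic k x : (0 < k)%N -> x ^+ 2 <= k%:R * x ^+ 4 + k%:R^-1.
Proof.
move=> k0; have k0' : 0 < k%:R :> R by rewrite ltr0n.
have -> : k%:R * x ^+ 4 + k%:R^-1 = ((k%:R * x ^+ 2) ^+ 2 + 1) / k%:R.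
  by field; rewrite gt_eqF.
rewrite ler_pdivlMr// mulrC; have := sqr_ge0 (k%:R * x ^+ 2 - 1); nra.
Qed.

(** With [y = a x] this reads [y^3 <= y^4 + 64]. It absorbs the effect on [a t] of the cubic error
    in [t]. *)
Lemma scaled_cube_le k x : (0 < k)%N -> 0 <= x ->
  a k * x ^+ 3 <= 8 * (k%:R * x ^+ 4 + k%:R^-1).
Proof.
move=> k0 x0; have k0' : 0 < k%:R :> R by rewrite ltr0n.
pose y := a k * x; have y0 : 0 <= y by rewrite mulr_ge0// ltW// median_scale_gt0.
have a2 : a k ^+ 2 = 8 * k%:R by exact: sqr_median_scale.
have -> : a k * x ^+ 3 = y ^+ 3 / (8 * k%:R).
  by rewrite -a2 /y; field; rewrite gt_eqF// median_scale_gt0.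
have -> : k%:R * x ^+ 4 = y ^+ 4 / (64 * k%:R).
  have -> : y ^+ 4 = (a k ^+ 2) ^+ 2 * x ^+ 4 by rewrite /y; ring.
  by rewrite a2; field; rewrite gt_eqF.
have -> : 8 * (y ^+ 4 / (64 * k%:R) + k%:R^-1) = (y ^+ 4 + 64) / (8 * k%:R).
  by field; rewrite gt_eqF.
rewrite ler_pM2r ?invr_gt0 ?mulr_gt0//.
have [y1|y1] := leP y 1; last by nra.
by have : y ^+ 3 <= 1 by [rewrite exprn_ile1]; have : 0 <= y ^+ 4 by [rewrite
    exprn_ge0]; lra.
Qed.

Variables (h0 C0 : R).
Hypotheses (h0_gt0 : 0 < h0) (C0_ge0 : 0 <= C0).

(** The cubic error is at most half of [h0 * x], and [3 / 2 * 6^-1 = 4^-1] brings [t] into the range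
    of [median_tail_ge]. *)
Lemma median_tail_near k x t : (0 < k)%N -> 0 <= x -> C0 * x ^+ 2 <= h0 / 2 ->
  h0 * x <= 6^-1 -> `|t - h0 * x| <= C0 * x ^+ 3 ->
  [/\ 0 <= t, t <= 3 / 2 * (h0 * x), h0 * x / 2 <= t & t <= 4^-1].
Proof.
move=> k0 x0 Cx hx; have : C0 * x ^+ 3 <= h0 / 2 * x.
  by rewrite exprSr mulrA ler_wpM2r.
have := mulr_ge0 (ltW h0_gt0) x0.
by rewrite ler_norml => ? ? /andP[? ?]; split; lra.
Qed.

Let e k x : R := k%:R * x ^+ 4 + k%:R^-1.

Let e_ge0 k x : 0 <= e k x.
Proof. by rewrite addr_ge0 ?invr_ge0// mulr_ge0// exprn_even_ge0. Qed.

Let quartic_le_e k x : k%:R * x ^+ 4 <= e k x.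
Proof. by rewrite lerDl invr_ge0. Qed.

Let invk_le_e k x : k%:R^-1 <= e k x.
Proof. by rewrite lerDr mulr_ge0// exprn_even_ge0. Qed.

Let e_dilate_le k c x t : 0 <= c -> `|t| <= c * `|x| ->
  e k t <= (1 + c ^+ 4) * e k x.
Proof.
move=> c0 tx; rewrite mulrDl mul1r /e [leLHS]addrC; apply: lerD; first exact: invk_le_e.
rewrite -/(e k x); apply: (@le_trans _ _ (c ^+ 4 * (k%:R * x ^+ 4))); last first.
  by rewrite ler_wpM2l ?exprn_ge0.
rewrite [leRHS]mulrCA ler_wpM2l//.
have abs4 (y : R) : y ^+ 4 = `|y| ^+ 4.
  by rewrite -normrX ger0_norm// exprn_even_ge0.
by rewrite (abs4 t) (abs4 x) -exprMn lerXn2r ?nnegrE// mulr_ge0.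
Qed.

(** The first summand comes from comparing [T t] with [Q(a t)], where [t <= 3 / 2 * h0 * x]; the
    others come from moving [a t] to [a h0 x] in the Gaussian tail. *)
Definition tail_error_cst : R :=
  g * (1 + (3 / 2 * h0) ^+ 4) + (8 * C0 + 10 * (C0 * h0)).

Lemma median_tail_local k x t : (0 < k)%N -> 0 <= x -> C0 * x ^+ 2 <= h0 / 2 ->
  h0 * x <= 6^-1 -> `|t - h0 * x| <= C0 * x ^+ 3 ->
  exists2 theta, `|theta| <= tail_error_cst * (k%:R * x ^+ 4 + k%:R^-1) &
    T k t = gauss_tail (a k * h0 * x) * expR theta.
Proof.
move=> k0 x0 Cx hx th; have [t0 tle tge t4] := median_tail_near k0 x0 Cx hx th.
have t04 : 0 <= t <= 4^-1 by rewrite t0.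
have a0 : 0 <= a k by exact/ltW/median_scale_gt0.
have hx0 : 0 <= h0 * x by rewrite mulr_ge0// ltW.
have [th1 th1_le ->] := median_tail_expR k0 t04.
have [th2 th2_le ->] := gauss_tail_shift (mulr_ge0 a0 t0) (mulr_ge0 a0 hx0).
exists (th2 + th1); last by rewrite -mulrA -expRD mulrA.
have H1 : `|th1| <= g * (1 + (3 / 2 * h0) ^+ 4) * e k x.
  apply: (le_trans th1_le); rewrite -mulrA; apply: ler_wpM2l => //.
  apply: e_dilate_le; first by rewrite mulr_ge0// ltW.
  by rewrite !ger0_norm//; move: tle; lra.
suff H2 : `|th2| <= (8 * C0 + 10 * (C0 * h0)) * e k x.
  rewrite /tail_error_cst -/(e k x) mulrDl addrC.
  by apply: le_trans (ler_normD _ _) _; exact: lerD.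
apply: le_trans th2_le _.
have d_le : `|a k * (h0 * x) - a k * t| <= C0 * (a k * x ^+ 3).
  by rewrite -mulrBr normrM ger0_norm// distrC mulrCA ler_wpM2l.
rewrite [leLHS]mulrDr mulr1 [leRHS]mulrDl; apply: lerD.
  apply: le_trans d_le _; rewrite [8 * C0]mulrC -[leRHS]mulrA.
  by apply: ler_wpM2l => //; exact: scaled_cube_le.
(* The mean of [a t] and [a h0 x] is at most [5 / 4 * a h0 x], and [a ^+ 2 = 8 k] yields the
   constant 10. *)
apply: (@le_trans _ _ (C0 * (a k * x ^+ 3) * (a k * (5 / 4 * (h0 * x))))).
  apply: ler_pM => //.
    exact: divr_ge0 (addr_ge0 (mulr_ge0 a0 t0) (mulr_ge0 a0 hx0)) (ler0n _ 2).
  by rewrite -mulrDr -mulrA ler_wpM2l//; lra.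
rewrite (_ : _ * _ = 10 * (C0 * h0) * (k%:R * x ^+ 4)).
  by apply: ler_wpM2l => //; rewrite !mulr_ge0// ltW.
transitivity (C0 * h0 * (5 / 4) * x ^+ 4 * a k ^+ 2); first by ring.
by rewrite sqr_median_scale; field.
Qed.

(** In order: the errors from [median_ratio], from [median_defect], from [t] replacing [h0 * x] in
    the Gaussian exponent, and from [v] replacing [h0]. *)
Definition pdf_error_cst : R :=
  g + 32 * (1 + (3 / 2 * h0) ^+ 4) + 10 * (C0 * h0) + 2 * C0 / h0.

Lemma median_pdf_local k x t v : (0 < k)%N -> C0 * x ^+ 2 <= h0 / 2 ->
  h0 * `|x| <= 6^-1 -> `|t - h0 * x| <= C0 * `|x| ^+ 3 ->
  `|v - h0| <= C0 * x ^+ 2 ->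
  exists2 theta, `|theta| <= pdf_error_cst * (k%:R * x ^+ 4 + k%:R^-1) &
    median_cst k * ((2^-1 - t) * (2^-1 + t)) ^+ k * v =
    a k * h0 / Num.sqrt (2 * pi) *
      expR (- (8 * k%:R * h0 ^+ 2 * x ^+ 2 / 2) + theta).
Proof.
move=> k0 Cx hx th hv.
have x2 : x ^+ 2 = `|x| ^+ 2 by rewrite real_normK ?num_real.
have hx0 : 0 <= h0 * `|x| by rewrite mulr_ge0// ltW.
have thx : `|t - h0 * x| <= h0 * `|x| / 2.
  apply: (le_trans th); rewrite exprSr mulrA -x2.
  by have := ler_wpM2r (normr_ge0 x) Cx; lra.
have tle : `|t| <= 3 / 2 * h0 * `|x|.
  have : `|h0 * x| = h0 * `|x| by rewrite normrM gtr0_norm.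
  have := ler_normD (t - h0 * x) (h0 * x); rewrite subrK; lra.
have [th1 th1_le E1] : exists2 th1, `|th1| <= g * e k x &
    median_ratio k = 1 * expR th1 :> R.
  have ge0 : 0 <= g * e k x by rewrite mulr_ge0.
  apply: expR_sandwich => //; rewrite mul1r.
    rewrite (le_trans _ (median_ratio_ge1 k0))// expR_le1 oppr_le0//.
  apply: le_trans (median_ratio_le_expR g_ge k0) _.
  rewrite ler_expR -mulrA; apply: ler_wpM2l => //.
  apply: le_trans (invk_le_e k x); rewrite ler_piMl ?invr_ge0//; lra.
have [th2 th2_le E2] : exists2 th2,
    `|th2| <= 32 * (1 + (3 / 2 * h0) ^+ 4) * e k x &
    median_defect k t = 1 * expR th2 :> R.
  have le2 : 32 * k%:R * t ^+ 4 <= 32 * (1 + (3 / 2 * h0) ^+ 4) * e k x.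
    rewrite -[leLHS]mulrA -[leRHS]mulrA; apply: ler_wpM2l; first exact: ler0n.
    apply: le_trans (quartic_le_e k t) _; apply: e_dilate_le => //.
    by rewrite mulr_ge0// ltW.
  have t0 : 0 <= 32 * k%:R * t ^+ 4.
    by apply: mulr_ge0; [exact: mulr_ge0 (ler0n _ _) (ler0n _ _)|exact: exprn_even_ge0].
  apply: expR_sandwich => //; rewrite mul1r.
    apply: le_trans (median_defect_ge _ _); last lra.
    by rewrite ler_expR lerN2.
  apply: le_trans (median_defect_le1 _ _) _; first lra.
  by rewrite -[leLHS]expR0 ler_expR (le_trans t0).
have [th3 th3_le E3] : exists2 th3,
    `|th3| <= 2 * C0 / h0 * e k x & v = h0 * expR th3.
  have c0 : 0 <= C0 * x ^+ 2 / h0.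
    exact: divr_ge0 (mulr_ge0 C0_ge0 (sqr_ge0 x)) (ltW h0_gt0).
  have c1 : C0 * x ^+ 2 / h0 <= 2^-1 by rewrite ler_pdivrMr//; lra.
  have [th3 th3_le E3] : exists2 th3,
      `|th3| <= 2 * (C0 * x ^+ 2 / h0) & v = h0 * expR th3.
    have vE : C0 * x ^+ 2 = h0 * (C0 * x ^+ 2 / h0) by field; rewrite gt_eqF.
    set c := C0 * x ^+ 2 / h0 in c0 c1 vE *; move: hv; rewrite vE.
    rewrite ler_norml => /andP[v1 v2]; apply: expR_sandwich => //.
      apply: (@le_trans _ _ (h0 * (1 - c))); last lra.
      rewrite ler_pM2l// expRN -[leLHS]mul1r ler_pdivrMr ?expR_gt0//.
      (* Here [(1 - c) * (1 + 2 * c) = 1 + c * (1 - 2 * c)], which is at least 1 because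
         [c <= 1 / 2]. *)
      apply: (@le_trans _ _ ((1 - c) * (1 + 2 * c))).
        by have /(mulr_ge0 c0) : 0 <= 1 - 2 * c by [lra]; lra.
      by apply: ler_wpM2l; [lra|exact: expR_ge1Dx].
    apply: (@le_trans _ _ (h0 * (1 + 2 * c))); first by nra.
    by rewrite ler_pM2l// expR_ge1Dx.
  exists th3 => //; apply: (le_trans th3_le).
  have -> : 2 * (C0 * x ^+ 2 / h0) = 2 * C0 / h0 * x ^+ 2 by field; rewrite gt_eqF.
  apply: ler_wpM2l; last exact: sqr_le_quartic.
  by rewrite divr_ge0 ?mulr_ge0// ltW.
pose th4 := 4 * k%:R * ((h0 * x) ^+ 2 - t ^+ 2).
have th4_le : `|th4| <= 10 * (C0 * h0) * e k x.
  apply: (@le_trans _ _ (10 * (C0 * h0) * (k%:R * x ^+ 4))); last first.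
    by apply: ler_wpM2l => //; rewrite !mulr_ge0// ltW.
  have -> : th4 = - (4 * k%:R * ((t - h0 * x) * (t + h0 * x))) by rewrite /th4; ring.
  rewrite normrN !normrM (ger0_norm (ler0n _ _)) normr_nat.
  have tx : `|t + h0 * x| <= 5 / 2 * (h0 * `|x|).
    have : `|h0 * x| = h0 * `|x| by rewrite normrM gtr0_norm.
    have := ler_normD t (h0 * x); lra.
  have := ler_pM (normr_ge0 _) (normr_ge0 _) th tx.
  move=> /(ler_wpM2l (mulr_ge0 (ler0n R 4) (ler0n R k))) /le_trans; apply.
  rewrite le_eqVlt; apply/orP; left; apply/eqP.
  have -> : x ^+ 4 = `|x| ^+ 4 by rewrite -normrX ger0_norm// exprn_even_ge0.
  by field.
exists (th1 + th2 + th4 + th3).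
  rewrite -/(e k x) /pdf_error_cst 3!mulrDl.
  by do 3 (apply: le_trans (ler_normD _ _) _; apply: lerD => //).
rewrite median_densityE// E1 E2 E3 /gauss_pdf exprMn sqr_median_scale !mul1r.
rewrite (_ : - (8 * k%:R * t ^+ 2 / 2) = - (8 * k%:R * h0 ^+ 2 * x ^+ 2 / 2) + th4).
  by rewrite !expRD; ring.
by rewrite /th4; field.
Qed.

(** The summands bound the three moves from [z] to [y], in the order [z] to [a t], [a h0 x] to
    [2 sqrt m h0 x], and [a t] to [a h0 x]. *)
Definition coupling_cst : R := 16 * g + 1 + C0 / (4 * h0 ^+ 3).

Lemma median_coupling_local k x t z :
  (0 < k)%N -> 0 <= x -> C0 * x ^+ 2 <= h0 / 2 ->
  h0 * x <= 6^-1 -> `|t - h0 * x| <= C0 * x ^+ 3 -> gauss_tail z = T k t ->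
  let m : R := k.*2.+1%:R in let y := 2 * h0 * Num.sqrt m * x in
  0 <= z /\ `|y - z| <= coupling_cst / m * (1 + y ^+ 3).
Proof.
move=> k0 x0 Cx hx th zT m y.
have [t0 tle tge t4] := median_tail_near k0 x0 Cx hx th.
have t04 : 0 <= t <= 4^-1 by rewrite t0.
have k0' : 0 < k%:R :> R by rewrite ltr0n.
have k1 : 1 <= k%:R :> R by rewrite ler1n.
have mE : m = 2 * k%:R + 1 by rewrite /m -addn1 natrD -mul2n natrM.
have m0 : 0 < m by rewrite mE; lra.
pose q := Num.sqrt m; have q0 : 0 < q by rewrite sqrtr_gt0.
have q2 : q ^+ 2 = m by rewrite sqr_sqrtr// ltW.
have a0 : 0 < a k by exact: median_scale_gt0.
have a2 : a k ^+ 2 = 8 * k%:R by exact: sqr_median_scale.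
(* Since [8 k = 4 (m - 1)], the scale [a] differs from [2 sqrt m] by at most [2 / sqrt m]. *)
have aq : a k <= 2 * q by rewrite -ler_sqr ?nnegrE ?mulr_ge0 ?ltW// exprMn q2 a2 mE; lra.
have qa : 2 * q - 2 / q <= a k.
  have -> : 2 * q - 2 / q = 2 * (m - 1) / q by rewrite -q2; field; rewrite gt_eqF.
  rewrite ler_pdivrMr// -ler_sqr ?nnegrE; last 2 first.
    by rewrite mulr_ge0// mE; lra.
    by rewrite mulr_ge0 ?ltW.
  rewrite !exprMn q2 a2 mE; nra.
have hx0 : 0 <= h0 * x by rewrite mulr_ge0// ltW.
have yE : y = 2 * q * (h0 * x) by rewrite /y -/q; ring.
have y0 : 0 <= y by rewrite yE mulr_ge0// mulr_ge0// ltW.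
pose s := a k * t; have s0 : 0 <= s by rewrite mulr_ge0// ltW.
have sz : s <= z.
  rewrite leNgt; apply/negP => /gauss_tail_lt; rewrite zT ltNge median_tail_le//.
  by apply/andP; split => //; lra.
split; first exact: le_trans sz.
have sy : s <= 3 / 2 * y.
  rewrite yE (le_trans (ler_wpM2l (ltW a0) tle))//.
  by have := ler_wpM2r hx0 aq; lra.
have zs : z - s <= 16 * g / m * (1 + y ^+ 3).
  have [theta th_le E] := median_tail_expR k0 t04.
  have := gauss_tail_expR_nonincreasing s0 sz.
  rewrite zT E -mulrA ler_pM2l ?gauss_tail_gt0// -expRD ler_expR => H1.
  have H2 : 3 / 4 * ((z - s) * (1 + s)) <= g * (k%:R * t ^+ 4 + k%:R^-1).
    have : - theta <= `|theta| by rewrite -normrN ler_norm.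
    have : (z - s) * (1 + s) <= (z - s) * (1 + (z + s) / 2).
      by apply: ler_wpM2l; lra.
    lra.
  have ktE : k%:R * t ^+ 4 = s ^+ 4 / (64 * k%:R).
    have -> : s ^+ 4 = (a k ^+ 2) ^+ 2 * t ^+ 4 by rewrite /s; ring.
    by rewrite a2; field; rewrite gt_eqF.
  (* The error is written with a factor [1 + s] so that it cancels the one gained from Mills' bound
     in [H2]. *)
  have H3 : k%:R * t ^+ 4 + k%:R^-1 <= 3 / m * ((1 + s) * (1 + s ^+ 3)).
    have kim : k%:R^-1 <= 3 / m.
      by rewrite ler_pdivlMr// ler_pdivrMl// mE; lra.
    apply: (@le_trans _ _ (k%:R^-1 * ((1 + s) * (1 + s ^+ 3)))); last first.
      by apply: ler_wpM2r => //; rewrite mulr_ge0// addr_ge0// exprn_ge0.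
    rewrite ktE (_ : _ / _ + _ = k%:R^-1 * (s ^+ 4 / 64 + 1)); last first.
      by field; rewrite gt_eqF.
    apply: ler_wpM2l; first by rewrite invr_ge0 ltW.
    have := exprn_ge0 3 s0; have := exprn_ge0 4 s0; have : s ^+ 4 = s * s ^+ 3 by ring.
    lra.
  have H4 : z - s <= 4 * g / m * (1 + s ^+ 3).
    have s1 : 0 < 1 + s by lra.
    rewrite -(ler_pM2r s1).
    have := le_trans H2 (ler_wpM2l g_ge0 H3).
    by move: (m^-1) => mi; lra.
  apply: (le_trans H4).
  rewrite -!mulrA (_ : 16 * (g * (m^-1 * (1 + y ^+ 3))) = 4 * (g * (m^-1 * (4 * (1 + y
      ^+ 3))))); last by ring.
  apply: ler_wpM2l => //; apply: ler_wpM2l => //; apply: ler_wpM2l.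
    by rewrite invr_ge0 ltW.
  have : s ^+ 3 <= (3 / 2 * y) ^+ 3.
    by apply: lerXn2r; rewrite ?nnegrE//; exact: le_trans sy.
  have -> : (3 / 2 * y) ^+ 3 = 27 / 8 * y ^+ 3 by field.
  by have := exprn_ge0 3 y0; lra.
have sa : `|s - a k * (h0 * x)| <= C0 / (4 * h0 ^+ 3) / m * y ^+ 3.
  rewrite /s -mulrBr normrM gtr0_norm//.
  apply: le_trans (ler_pM (ltW a0) (normr_ge0 _) aq th) _.
  rewrite le_eqVlt; apply/orP; left; apply/eqP.
  by rewrite yE -q2; field; rewrite !gt_eqF.
have ya : `|y - a k * (h0 * x)| <= y / m.
  rewrite yE -mulrBl ger0_norm; last by rewrite mulr_ge0// subr_ge0.
  rewrite [leRHS]mulrAC ler_wpM2r//.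
  have -> : 2 * q / m = 2 / q by rewrite -q2; field; rewrite gt_eqF.
  by rewrite lerBlDr -lerBlDl.
have ym : y / m <= 1 / m * (1 + y ^+ 3).
  rewrite mul1r mulrC; apply: ler_wpM2l; first by rewrite invr_ge0 ltW.
  have [y1|y1] := leP y 1; first by have := exprn_ge0 3 y0; lra.
  by have : y * 1 <= y * y ^+ 2 by [apply: ler_wpM2l => //; nra]; lra.
have C4 : C0 / (4 * h0 ^+ 3) / m * y ^+ 3 <= C0 / (4 * h0 ^+ 3) / m * (1 + y ^+ 3).
  apply: ler_wpM2l; last by lra.
  by rewrite !divr_ge0 ?mulr_ge0 ?exprn_ge0// ltW.
have -> : coupling_cst / m * (1 + y ^+ 3) = 16 * g / m * (1 + y ^+ 3) +
    1 / m * (1 + y ^+ 3) + C0 / (4 * h0 ^+ 3) / m * (1 + y ^+ 3).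
  by rewrite /coupling_cst !mulrDl.
move: zs ym (le_trans sa C4) (le_trans ya ym) sz.
move: (16 * g / m * _) => A; move: (1 / m * _) => B; move: (_ / m * _) => D.
move: (a k * _) => w; rewrite !ler_norml => ? ? /andP[? ?] /andP[? ?] ?.
by apply/andP; split; lra.
Qed.

End local_expansion.

(** * Law of the sample median *)

Section law_from_rays.
Context {R : realType}.

(** Open right rays generate the Borel sets and are stable under intersection; their measures follow
    by complement from the left rays, the total masses being 1. *)
Lemma measure_eq_rays (m1 m2 : {measure set R -> \bar R}) :
  m1 setT = 1%E -> m2 setT = 1%E ->
  (forall x : R, m1 `]-oo, x]%classic = m2 `]-oo, x]%classic) ->
  forall A : set R, measurable A -> m1 A = m2 A.
Proof.
move=> m11 m21 m12 A mA.
have fin1 (B : set R) : measurable B -> (m1 B < +oo)%E.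
  by move=> mB; rewrite (@le_lt_trans _ _ 1%E) ?ltry// -m11 le_measure ?inE.
have fin2 (B : set R) : measurable B -> (m2 B < +oo)%E.
  by move=> mB; rewrite (@le_lt_trans _ _ 1%E) ?ltry// -m21 le_measure ?inE.
apply: (@measure_unique _ _ R (@RGenOInfty.G R)
  (fun n => `]- n%:R, +oo[%classic)) => //.
- exact: RGenOInfty.measurableE.
- move=> _ _ [x ->] [y ->]; exists (Num.max x y).
  apply/seteqP; split => z /=; rewrite !in_itv/= !andbT gt_max.
    by move=> [-> ->].
  by move=> /andP[].
- by move=> i; exists (- i%:R).
- rewrite -subTset => x _; exists (Num.truncn `|x|).+1 => //=.
  rewrite in_itv/= andbT ltrNl (le_lt_trans (ler_norm _))// normrN.
  exact: truncnS_gt.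
- move=> _ [x ->]; rewrite -setCitvl.
  have := m12 x; set I := [set` _] => mI.
  have mI' : measurable (I : set R) by exact: measurable_itv.
  have mT : measurable (setT : set R) by [].
  rewrite -setTD (measureD mT mI' (fin1 _ mT)) (measureD mT mI' (fin2 _ mT)).
  by congr (_ - _)%E; [exact: etrans m11 (esym m21)|rewrite setTI; exact: mI].
- by move=> n; apply: fin1; exact: measurable_itv.
Qed.

End law_from_rays.

(** * Distribution function of a density *)

Section density.
Context {R : realType}.
Variable h : R -> R.
Hypothesis h_density : is_density h.

Definition dist_of_density (x : R) : R :=
  fine (\int[lebesgue_measure]_(t in `]-oo, x]) (h t)%:E)%E.

Let mh (A : set R) : measurable_fun A (fun t => (h t)%:E).
Proof.
have [mh _ _] := h_density.
by apply/measurable_EFinP; exact: measurable_funTS.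
Qed.

Let h_ge0 (t : R) : (0 <= (h t)%:E)%E.
Proof. by have [_ h0 _] := h_density; rewrite lee_fin. Qed.

Let int_fin (A : set R) : measurable A ->
  (\int[lebesgue_measure]_(t in A) (h t)%:E)%E \is a fin_num.
Proof.
move=> mA; have [_ _ h1] := h_density.
rewrite ge0_fin_numE; last by apply: integral_ge0.
apply: (@le_lt_trans _ _ 1%E); last exact: ltry.
by rewrite -h1; apply: ge0_subset_integral => //; exact: mh.
Qed.

Lemma dist_of_density_bounds (x y l u : R) : 0 <= l -> x <= y ->
  (forall t, x < t <= y -> l <= h t <= u) ->
  l * (y - x) <= dist_of_density y - dist_of_density x <= u * (y - x).
Proof.
move=> l0 xy hlu.
have itvE : `]-oo, y]%classic = `]-oo, x] `|` `]x, y] :> set R.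
  apply/seteqP; split => t /=; rewrite !in_itv/=.
    by move=> ty; have [tx|xt] := leP t x; [left|right].
  by move=> [tx|/andP[]//]; exact: le_trans xy.
have Hy : dist_of_density y =
    dist_of_density x + fine (\int[lebesgue_measure]_(t in `]x, y]) (h t)%:E)%E.
  rewrite /dist_of_density itvE ge0_integral_setU//; first by rewrite fineD// int_fin.
    exact: mh.
  rewrite disj_set2E; apply/eqP; rewrite -subset0 => t [/=].
  by rewrite !in_itv/= => tx /andP[/(le_lt_trans tx)]; rewrite ltxx.
have cst_int c : (\int[lebesgue_measure]_(t in `]x, y]) (cst c%:E) t =
    (c * (y - x))%:E)%E.
  rewrite integral_cst//= lebesgue_measure_itv/= lte_fin.
  case: ifPn => [_|]; first by rewrite EFinM.
  by rewrite -leNgt mule0 => yx; rewrite (@le_anti _ _ x y) ?xy// subrr mulr0.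
rewrite Hy addrAC subrr add0r -!lee_fin fineK ?int_fin// -!cst_int.
apply/andP; split; apply: ge0_le_integral => //=; try exact: mh.
- by move=> t; rewrite in_itv/= => /hlu /andP[? _]; rewrite lee_fin.
- by move=> t; rewrite in_itv/= => /hlu /andP[_ ?]; rewrite lee_fin.

Qed.

Lemma dist_fun_density d (T : measurableType d) (P : probability T R)
    (X : {RV P >-> R}) : has_density X h -> dist_fun X = dist_of_density.
Proof. by move=> hX; apply/funext => x; rewrite /dist_fun /cdf hX. Qed.

Lemma dist_of_density01 x : 0 <= dist_of_density x <= 1.
Proof.
have [_ _ h1] := h_density.
rewrite -!lee_fin fineK ?int_fin// integral_ge0//=.
by rewrite -h1; apply: ge0_subset_integral => //; exact: mh.


Qed.

End density.

(** * Distribution function of the median of independent variables *)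

Section median_law.
Context d {T : measurableType d} {R : realType} {P : probability T R}.
Variables (k : nat) (X : 'I_k.*2.+1 -> {RV P >-> R}).

Lemma median_fun_le x w :
  (median_fun X w <= x) = (k < #|[set i | (X i w <= x)%R]%SET|)%N.
Proof.
set s := [seq X i w | i <- enum 'I_k.*2.+1].
have -> : #|[set i | (X i w <= x)%R]%SET| = count (<= x) (sort <=%R s).
  rewrite count_sort count_map cardE enumT size_filter.
  by apply: eq_count => i /=; rewrite inE.
have ks : (k < size (sort <=%R s))%N.
  by rewrite size_sort size_map size_enum_ord ltnS -addnn leq_addr.
apply/idP/idP => [|ks']; last by apply: nth_count_le => //; exact: sort_le_sorted.
apply: contraTT; rewrite -leqNgt -ltNge => sk.
by apply: nth_count_gt; [exact: sort_le_sorted|rewrite sk ks].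
Qed.

(** The event is split according to the exact set [J] of indices whose sample is at most [x]. These
    events are disjoint, independence gives their probabilities, and sets of equal size are then
    counted together. *)
Lemma dist_fun_median x u : mutually_independent X ->
  (forall i, dist_fun (X i) x = u) ->
  dist_fun (sample_median X) x = median_cdf k u.
Proof.
move=> indX Xu.
pose A (J : {set 'I_k.*2.+1}) i : set R :=
  if i \in J then `]-oo, x]%classic else `]x, +oo[%classic.
pose E J := \bigcap_(i in [set i | i \in [set: 'I_k.*2.+1]%SET]) (X i @^-1` A J i).
have mA J i : measurable (A J i) by rewrite /A; case: ifP.
have mE J : measurable (E J).
  by apply: fin_bigcap_measurable => // i _; exact: measurable_funPTI.
have EP J w : E J w <-> J = [set i | X i w <= x]%SET.
  split => [EJ|-> i _ /=].
    apply/setP => i; have := EJ i; rewrite /= inE => /(_ isT).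
    rewrite /A inE; case: ifP => _ /=; rewrite in_itv/= ?andbT; first by move=> ->.
    by rewrite ltNge => /negbTE ->.
  by rewrite /A inE; case: ifP => ix /=; rewrite in_itv/= ?andbT// ltNge ix.
have PE J : P (E J) = (u ^+ #|J| * (1 - u) ^+ (k.*2.+1 - #|J|))%:E.
  rewrite /E indX//.
  transitivity (\prod_(i < k.*2.+1) (if i \in J then u else 1 - u)%:E)%E.
    apply: eq_big => [i|i _]; first by rewrite inE.
    have Pi : P (X i @^-1` `]-oo, x]) = u%:E.
      by rewrite -(Xu i) /dist_fun fineK// fin_num_measure.
    rewrite /A; case: ifP => // _.
    have mXi : measurable (X i @^-1` `]-oo, x]) by exact: measurable_funPTI.
    rewrite -setCitvl preimage_setC (probability_setC _ mXi).
    by have := congr1 (fun z => (1 - z)%E) Pi.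
  rewrite prodEFin; congr EFin.
  rewrite (bigID (mem J))/= (eq_bigr (fun=> u)) => [|i ->//].
  rewrite [X in _ * X](eq_bigr (fun=> 1 - u)) => [|i /negbTE ->//].
  rewrite !prodr_const; congr (_ ^+ _ * _ ^+ _).
  have cJ : (#|J| + #|[predC J]| = k.*2.+1)%N by rewrite cardC card_ord.
  transitivity #|[predC J]|; first exact: eq_card.
  by rewrite -(addKn #|J| #|[predC J]|) cJ.

rewrite /dist_fun /cdf /distribution /pushforward.
have -> : sample_median X @^-1` `]-oo, x] =
    \bigcup_(J in [set` [pred J : {set 'I_k.*2.+1} | (k < #|J|)%N]]) E J.
  apply/seteqP; split => w /=; rewrite in_itv/= median_fun_le.
    by move=> kJ; exists [set i | X i w <= x]%SET => //; exact/EP.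
  by move=> [J /= kJ /EP <-].
rewrite measure_fin_bigcup//; last by move=> J J' _ _ [w [/EP -> /EP ->]].
rewrite -(@bigfs _ _ _ _ (index_enum {set 'I_k.*2.+1}))//; last 2 first.
- exact: index_enum_uniq.
- by move=> J _; rewrite mem_index_enum.
rewrite (eq_bigr (fun J : {set 'I_k.*2.+1} =>
  (u ^+ #|J| * (1 - u) ^+ (k.*2.+1 - #|J|))%:E)) => [|J _]; last exact: PE.
have Jn (J : {set 'I_k.*2.+1}) : (#|J| < k.*2.+2)%N.
  by rewrite ltnS -[leqRHS]card_ord max_card.
(* [inord] loses nothing, as [Jn] bounds the size of [J]. *)
rewrite sumEFin/= (partition_big (fun J : {set 'I_k.*2.+1} => inord #|J| : 'I_k.*2.+2)
  (fun j : 'I_k.*2.+2 => (k < j)%N))/=; last first.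
  by move=> J kJ; rewrite (inordK (Jn J)).
rewrite /median_cdf big_geq_mkord; apply: eq_bigr => j kj.
rewrite (eq_big (fun J : {set 'I_k.*2.+1} =>
    J \in [set A : {set 'I_k.*2.+1} | #|A| == j]%SET)
  (fun=> u ^+ j * (1 - u) ^+ (k.*2.+1 - j))).
- by rewrite sumr_const card_draws card_ord -[LHS]mulr_natl mulrA.
- move=> J; rewrite inE -val_eqE/= (inordK (Jn J)).
  by apply/andP/idP => [[]//|/eqP ->]; split.
- by move=> J /andP[_ /eqP <-]; rewrite (inordK (Jn J)).
Qed.

End median_law.

(** * The quantile coupling *)

Section quantile.
Context d {T : measurableType d} {R : realType} {P : probability T R}.
Variable X : {RV P >-> R}.

Definition quantile (p : R) : R := inf [set x | p <= dist_fun X x].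

Lemma dist_fun_le x y : x <= y -> dist_fun X x <= dist_fun X y.
Proof. by move=> xy; rewrite fine_le ?fin_num_measure// cdf_nondecreasing. Qed.

Lemma dist_fun_ge0 x : 0 <= dist_fun X x.
Proof. by rewrite fine_ge0. Qed.

Lemma dist_fun_le1 x : dist_fun X x <= 1.
Proof. by rewrite -[leRHS]/(fine 1%E) fine_le ?fin_num_measure// cdf_le1. Qed.

(** The Galois connection of the generalised inverse. Right continuity of the cdf puts the infimum
    itself in the set. *)
Lemma quantile_le (p x : R) : 0 < p -> p < 1 ->
  (quantile p <= x) = (p <= dist_fun X x).
Proof.
move=> p0 p1.
have S0 : [set x | p <= dist_fun X x] !=set0.
  have /cvgrPdist_lt/(_ (1 - p)) : dist_fun X y @[y --> +oo] --> (1 : R).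
    by apply: (fine_cvg (cvg_cdfy1 X)).
  rewrite subr_gt0 => /(_ p1) /filter_ex[y]; rewrite /= => yp.
  by exists y => /=; move: yp; rewrite ltr_norml => /andP[_]; lra.
have S1 : has_lbound [set x | p <= dist_fun X x].
  have /cvgrPdist_lt/(_ p p0) : dist_fun X y @[y --> -oo] --> (0 : R).
    by apply: (fine_cvg (cvg_cdfNy0 X)).
  move=> /filter_ex[y]; rewrite /= sub0r normrN ltr_norml => /andP[_ yp].
  exists y => z /= pz; rewrite leNgt; apply/negP => /ltW/dist_fun_le.
  by move=> /(le_trans pz); rewrite leNgt yp.
apply/idP/idP => [qx|px]; last exact: ge_inf.
apply: le_trans (dist_fun_le qx); set q := quantile p.
have : dist_fun X y @[y --> q^'+] --> dist_fun X q.
  apply: fine_cvg; rewrite fineK ?fin_num_measure//; exact: cdf_right_continuous.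
move=> /cvgr_to_ge; apply; near=> y.
have [s /= ps sy] : exists2 s, p <= dist_fun X s & s < y by apply: inf_lt.
by apply: le_trans ps _; exact/dist_fun_le/ltW.
Unshelve. all: by end_near. Qed.

End quantile.

Section gaussian_quantile.
Context {R : realType}.

Lemma Phi_lt (x y : R) : x < y -> Phi x < Phi y.
Proof. by move=> /(@gauss_tail_lt R); rewrite /gauss_tail; lra. Qed.

Lemma Phi_le (x y : R) : (Phi x <= Phi y) = (x <= y).
Proof.
apply/idP/idP => [|xy]; last by have := @gauss_tail_le R _ _ xy; rewrite /gauss_tail; lra.
by apply: contraTT; rewrite -!ltNge; exact: Phi_lt.
Qed.

Lemma Phi_gt0 (x : R) : 0 < Phi x.
Proof. by rewrite -[x]opprK PhiN gauss_tail_gt0. Qed.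

Lemma Phi_lt1 (x : R) : Phi x < 1.
Proof. by have := gauss_tail_gt0 x; rewrite /gauss_tail; lra. Qed.

Lemma Phi_surjective (c : R) : 0 < c -> c < 1 -> exists z, Phi z = c.
Proof.
move=> c0 c1.
have [y yc] : exists y, c < Phi y.
  have /cvgrPdist_lt/(_ (1 - c)) := @cvg_Phi R.
  rewrite subr_gt0 => /(_ c1) /filter_ex[y]; rewrite /= ltr_norml => /andP[_ yc].
  by exists y; lra.
have [x xc] : exists x, Phi (- x) < c.
  have /cvgrPdist_lt/(_ c c0)/filter_ex[x] := @cvg_PhiN R.
  by rewrite /= sub0r normrN ltr_norml => /andP[_ xc]; exists x.
have xy : - x <= y by rewrite -Phi_le (ltW (lt_trans xc yc)).
have [||z _ zc] := @IVT R (@Phi R) (- x) y c xy; last by exists z.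
  apply: derivable_within_continuous => t _.
  by have [] := is_derive_Phi t.
by rewrite ge_min le_max (ltW xc) (ltW yc) orbT.
Qed.

(** [Phi] of a standard normal variable is uniform. The values 0 and 1 are separate cases because
    [Phi] does not attain them. *)
Lemma normal_prob_Phi_le (c : R) : 0 <= c -> c <= 1 ->
  normal_prob 0 1 [set z : R | Phi z <= c] = c%:E.
Proof.
rewrite le_eqVlt => /predU1P[<- _|c0].
  have -> : [set z : R | Phi z <= 0] = set0; last by rewrite measure0.
  by rewrite -subset0 => z /=; rewrite leNgt Phi_gt0.
rewrite le_eqVlt => /predU1P[->|c1].
  have -> : [set z : R | Phi z <= 1] = setT; last exact: probability_setT.
  by rewrite -subTset => z _ /=; rewrite ltW// Phi_lt1.
have [z <-] := Phi_surjective c0 c1.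
have -> : [set t : R | Phi t <= Phi z] = [set` `]-oo, z]].
  by apply/seteqP; split => t /=; rewrite in_itv/= Phi_le.
by rewrite /Phi fineK// fin_num_measure.
Qed.

End gaussian_quantile.

Section quantile_coupling.
Context d {T : measurableType d} {R : realType} {P : probability T R}.
Variable X : {RV P >-> R}.

Let f (z : R) : R := quantile X (Phi z).

Let mf : measurable_fun [set: R] f.
Proof.
apply: nondecreasing_measurable => //= x y xy.
rewrite /f quantile_le ?Phi_gt0 ?Phi_lt1// (@le_trans _ _ (Phi y)) ?Phi_le//.
by rewrite -quantile_le ?Phi_gt0 ?Phi_lt1.
Qed.

HB.instance Definition _ := isMeasurableFun.Build _ _ _ _ f mf.

Definition quantile_coupling : {mfun R >-> R} := f.

Lemma quantile_coupling_le z x : (quantile_coupling z <= x) = (Phi z <= dist_fun X x).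
Proof. by rewrite quantile_le ?Phi_gt0 ?Phi_lt1. Qed.

(** By the Galois connection, the coupled variable is at most [x] exactly when the uniform variable
    [Phi Z] is at most [dist_fun X x]; agreement on left rays determines the law. *)
Lemma quantile_coupling_law d' (T' : measurableType d') (P' : probability T' R)
    (Z : {RV P' >-> R}) : is_std_normal Z ->
  eq_law (distribution P' (quantile_coupling \o Z)) (distribution P X).
Proof.
move=> Zn A mA.
apply: measure_eq_rays => //; try exact: probability_setT.
move=> x; rewrite /distribution /pushforward.
transitivity (distribution P' Z [set z : R | Phi z <= dist_fun X x]).
  rewrite /distribution /pushforward; congr (P' _); apply/seteqP.
  by split => w /=; rewrite in_itv/= quantile_coupling_le.
rewrite Zn; last first.
  have -> : [set z : R | Phi z <= dist_fun X x] = quantile_coupling @^-1` `]-oo, x].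
    by apply/seteqP; split => z /=; rewrite in_itv/= quantile_coupling_le.
  exact: measurable_funPTI.
rewrite normal_prob_Phi_le ?dist_fun_ge0 ?dist_fun_le1//.
by rewrite /dist_fun fineK// fin_num_measure.
Qed.

End quantile_coupling.

(** * The sample median of a density flat at 0 *)

Section density_expansion.
Context {R : realType}.
Variables (h : R -> R) (C0 rho : R).
Hypothesis h_density : is_density h.
Hypothesis h_half :
  (\int[lebesgue_measure]_(x in `]-oo, 0%R]) (h x)%:E = (2^-1 : R)%:E)%E.
Hypothesis h0_gt0 : 0 < h 0.
Hypothesis C0_ge0 : 0 <= C0.
Hypothesis rho_small : C0 * rho ^+ 2 <= h 0 / 2.
Hypothesis h_flat : forall x, `|x| <= rho -> `|h x - h 0| <= C0 * x ^+ 2.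

Local Notation H := (dist_of_density h).

Lemma dist_of_density0 : H 0 = 2^-1.
Proof. by rewrite /dist_of_density h_half. Qed.

Lemma flat_le x : `|x| <= rho -> C0 * x ^+ 2 <= h 0 / 2.
Proof.
move=> xr; apply: le_trans rho_small; apply: ler_wpM2l => //.
by rewrite -[x ^+ 2]real_normK ?num_real// lerXn2r ?nnegrE// (le_trans _ xr).
Qed.

(** The flatness bound on [h] is integrated between 0 and [x], starting from [H 0 = 1 / 2]. *)
Lemma dist_of_density_expansion x : `|x| <= rho ->
  `|H x - 2^-1 - h 0 * x| <= C0 * `|x| ^+ 3.
Proof.
move=> xr; have l0 : 0 <= h 0 - C0 * x ^+ 2 by have := flat_le xr; move: h0_gt0; lra.
have hx t : `|t| <= `|x| -> h 0 - C0 * x ^+ 2 <= h t <= h 0 + C0 * x ^+ 2.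
  move=> tx; have := h_flat (le_trans tx xr).
  have : C0 * t ^+ 2 <= C0 * x ^+ 2.
    apply: ler_wpM2l => //; rewrite -[t ^+ 2]real_normK ?num_real//.
    by rewrite -[x ^+ 2]real_normK ?num_real// lerXn2r ?nnegrE.
  by rewrite ler_norml => ? /andP[? ?]; apply/andP; split; lra.
rewrite -dist_of_density0; have [x0|x0] := leP 0 x.
  have B t : 0 < t <= x -> h 0 - C0 * x ^+ 2 <= h t <= h 0 + C0 * x ^+ 2.
    by move=> /andP[t0 tx]; apply: hx; rewrite !ger0_norm// ltW.
  have /andP[] := dist_of_density_bounds h_density l0 x0 B.
  by rewrite (ger0_norm x0) ler_norml => ? ?; apply/andP; split; lra.
have B t : x < t <= 0 -> h 0 - C0 * x ^+ 2 <= h t <= h 0 + C0 * x ^+ 2.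
  by move=> /andP[xt t0]; apply: hx; rewrite !ler0_norm ?lerN2// ltW.
have /andP[] := dist_of_density_bounds h_density l0 (ltW x0) B.
by rewrite (ltr0_norm x0) ler_norml => ? ?; apply/andP; split; lra.
Qed.

Lemma dist_of_density_lipschitz x y : x <= y -> `|x| <= rho -> `|y| <= rho ->
  0 <= H y - H x <= 2 * h 0 * (y - x).
Proof.
move=> xy xr yr; have l0 : 0 <= (0 : R) by [].
have := @dist_of_density_bounds R h h_density x y 0 (2 * h 0) l0 xy.
rewrite mul0r; apply=> t /andP[xt ty].
have tr : `|t| <= rho.
  move: xr yr; rewrite !ler_norml => /andP[? ?] /andP[? ?].
  by apply/andP; split; lra.
by have := h_flat tr; have := flat_le tr; rewrite ler_norml => ? /andP[? ?]; apply/andP;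
    split; lra.
Qed.

Lemma median_cdf_lipschitz k (u v : R) : 0 <= u -> u <= v -> v <= 1 ->
  median_cdf k v - median_cdf k u <= median_cst k * (v - u).
Proof.
move=> u0 uv v1; have := @le0_is_derive_le R (fun w => median_cdf k w - median_cst k * w)
  (fun w => median_cst k * (w * (1 - w)) ^+ k - median_cst k) u v.
suff -> : (median_cdf k v - median_cdf k u <= median_cst k * (v - u)) =
  (median_cdf k v - median_cst k * v <= median_cdf k u - median_cst k * u).
  apply => // w.
    by move=> _; have D := is_derive_median_cdf k w; derive; ring.
  move=> /andP[uw wv]; rewrite subr_le0 ger_pMr ?median_cst_gt0//.
  by rewrite exprn_ile1//; nra.
by apply/idP/idP; lra.
Qed.

Section sample.
Context (k : nat) d (T : measurableType d) (P : probability T R)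
  (xi : 'I_k.*2.+1 -> {RV P >-> R}).
Hypothesis k0 : (0 < k)%N.
Hypothesis xi_iid : iid_density xi h.
Hypothesis rho_le : h 0 * rho <= 6^-1.
Variable g : R.
Hypothesis g_ge : 2 ^+ 11 <= g.

Local Notation G := (dist_fun (sample_median xi)).
Local Notation m := (k.*2.+1%:R : R).
Local Notation q := (Num.sqrt (k.*2.+1%:R : R)).
Local Notation e x := (k%:R * x ^+ 4 + k%:R^-1).

Lemma dist_fun_sample_median x : G x = median_cdf k (H x).
Proof.
have [indep dens] := xi_iid; apply: dist_fun_median => // i.
by rewrite (dist_fun_density (dens i)).
Qed.

Lemma sample_median_upper x : 1 - G x = median_tail k (H x - 2^-1).
Proof.
rewrite dist_fun_sample_median -median_cdf_onem /median_tail.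
by congr median_cdf; field.
Qed.

Lemma sample_median_lower x : G x = median_tail k (2^-1 - H x).
Proof.
rewrite dist_fun_sample_median /median_tail.
by congr median_cdf; field.
Qed.

Let scaled_le (x : R) : `|x| <= rho -> h 0 * `|x| <= 6^-1.
Proof. by move=> xr; apply: le_trans rho_le; rewrite ler_pM2l. Qed.

Lemma sample_median_pdf (x : R) : `|x| <= rho ->
  exists2 theta, `|theta| <= pdf_error_cst g (h 0) C0 * e x &
    median_pdf k (dist_fun (xi ord0)) h x =
    Num.sqrt (8 * k%:R) * h 0 / Num.sqrt (2 * pi) *
      expR (- (8 * k%:R * h 0 ^+ 2 * x ^+ 2 / 2) + theta).
Proof.
move=> xr; have [_ dens] := xi_iid.
have [theta theta_le E] := median_pdf_local g_ge h0_gt0 C0_ge0 k0 (flat_le xr)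
  (scaled_le xr) (dist_of_density_expansion xr) (h_flat xr).
exists theta => //; rewrite -E /median_pdf (dist_fun_density (dens ord0)).
have -> : 2^-1 - (H x - 2^-1) = 1 - H x by field.
have -> : 2^-1 + (H x - 2^-1) = H x by field.
by rewrite exprMn /median_cst; ring.
Qed.

Lemma sample_median_upper_tail (x : R) : 0 < x -> x <= rho ->
  exists2 theta, `|theta| <= tail_error_cst g (h 0) C0 * e x &
    1 - G x = (1 - Phi (Num.sqrt (8 * k%:R) * h 0 * x)) * expR theta.
Proof.
move=> x0 xr; have x00 := ltW x0; have nx : `|x| = x by rewrite ger0_norm.
have xr' : `|x| <= rho by rewrite nx.
have ex := dist_of_density_expansion xr'; rewrite nx in ex.
have sc := scaled_le xr'; rewrite nx in sc.
have := median_tail_local g_ge h0_gt0 C0_ge0 k0 x00 (flat_le xr') sc ex.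
by rewrite sample_median_upper.
Qed.

Lemma sample_median_lower_tail (x : R) : 0 < x -> x <= rho ->
  exists2 theta, `|theta| <= tail_error_cst g (h 0) C0 * e x &
    G (- x) = Phi (- (Num.sqrt (8 * k%:R) * h 0 * x)) * expR theta.
Proof.
move=> x0 xr; have x00 := ltW x0; have nx : `|- x| = x by rewrite normrN ger0_norm.
have xr' : `|- x| <= rho by rewrite nx.
have ex : `|2^-1 - H (- x) - h 0 * x| <= C0 * x ^+ 3.
  have := dist_of_density_expansion xr'; rewrite nx.
  by rewrite -normrN; congr (`|_| <= _); ring.
have fl := flat_le xr'; rewrite sqrrN in fl.
have sc := scaled_le xr'; rewrite nx in sc.
have := median_tail_local g_ge h0_gt0 C0_ge0 k0 x00 fl sc ex.
by rewrite sample_median_lower PhiN.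
Qed.

(** For negative [x] the positive case is applied to [- x] and [- z], with the lower tail in place
    of the upper one. *)
Lemma sample_median_coupling (x z : R) : `|x| <= rho -> G x = Phi z ->
  `|2 * h 0 * q * x - z| <= coupling_cst g (h 0) C0 / m * (1 + `|2 * h 0 * q * x| ^+ 3).
Proof.
have c0 : 0 <= 2 * h 0 * q by rewrite !mulr_ge0// ltW.
move=> xr Gz; have [x0|x0] := leP 0 x.
  have nx : `|x| = x by rewrite ger0_norm.
  have ex := dist_of_density_expansion xr; rewrite nx in ex.
  have sc := scaled_le xr; rewrite nx in sc.
  have Tz : gauss_tail z = median_tail k (H x - 2^-1).
    by rewrite -sample_median_upper Gz.
  have [_] := median_coupling_local g_ge h0_gt0 C0_ge0 k0 x0 (flat_le xr) sc ex Tz.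
  by rewrite [`|2 * h 0 * q * x|]ger0_norm// mulr_ge0.
have nx : `|x| = - x by rewrite ltr0_norm.
have ex : `|2^-1 - H x - h 0 * - x| <= C0 * (- x) ^+ 3.
  have := dist_of_density_expansion xr; rewrite nx.
  by rewrite -normrN; congr (`|_| <= _); ring.
have fl := flat_le xr; rewrite -sqrrN in fl.
have sc := scaled_le xr; rewrite nx in sc.
have Tz : gauss_tail (- z) = median_tail k (2^-1 - H x).
  by rewrite -sample_median_lower Gz -PhiN opprK.
have x0' : 0 <= - x by rewrite oppr_ge0 ltW.
have [_] := median_coupling_local g_ge h0_gt0 C0_ge0 k0 x0' fl sc ex Tz.
have -> : 2 * h 0 * q * - x - - z = - (2 * h 0 * q * x - z) by ring.
have -> : `|2 * h 0 * q * x| = 2 * h 0 * q * - x.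
  by rewrite mulrN ler0_norm// mulr_ge0_le0// ltW.
by rewrite normrN.
Qed.

(** A jump of [G] at the quantile would break the equality. Near 0 there is none: [G] is the
    polynomial [median_cdf k] composed with [H], and both are Lipschitz there. *)
Lemma dist_fun_quantile_coupling z :
  `|quantile_coupling (sample_median xi) z| < rho ->
  G (quantile_coupling (sample_median xi) z) = Phi z.
Proof.
set x := quantile_coupling _ _ => xr.
have Gx : Phi z <= G x by rewrite -quantile_coupling_le.
apply/eqP; rewrite eq_le Gx andbT; apply/ler_addgt0Pr => c c0.
have K0 : 0 < median_cst k * (2 * h 0).
  by rewrite mulr_gt0 ?median_cst_gt0// mulr_gt0.
(* The step [b] keeps [x - b] in the flat neighbourhood and lets [G] vary by at most [c]. *)
pose b := Num.min (rho - `|x|) (c / (median_cst k * (2 * h 0))).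
have b0 : 0 < b by rewrite lt_min subr_gt0 xr divr_gt0.
have br : b <= rho - `|x| by rewrite ge_min lexx.
have bc : median_cst k * (2 * h 0 * b) <= c.
  by rewrite mulrA mulrC -ler_pdivlMr// ge_min lexx orbT.
have yx : x - b <= x by rewrite gerBl ltW.
have yr : `|x - b| <= rho.
  by rewrite (le_trans (ler_normB _ _))// (gtr0_norm b0) addrC -lerBrDr.
have Gy : G (x - b) < Phi z.
  by rewrite ltNge -quantile_coupling_le -ltNge -/x ltrBlDr ltrDl.
have /andP[H1 H2] := dist_of_density_lipschitz yx yr (ltW xr).
have /andP[Hy0 _] := dist_of_density01 h_density (x - b).
have /andP[_ Hx1] := dist_of_density01 h_density x.
rewrite subr_ge0 in H1.
have := median_cdf_lipschitz k Hy0 H1 Hx1.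
rewrite -!dist_fun_sample_median => L.
have L2 : G x - G (x - b) <= c.
  apply: (le_trans L); apply: le_trans bc; rewrite ler_pM2l ?median_cst_gt0//.
  by apply: le_trans H2 _; rewrite opprB addrC subrK.
by move: L2 Gy; lra.
Qed.

(* The upper tail of the median is dominated by the Gaussian one with no extra
   constant, so this needs no lower bound on k. *)
Lemma quantile_coupling_small r z : 0 < r -> r < rho ->
  `|z| <= h 0 * r / 2 * q -> `|quantile_coupling (sample_median xi) z| <= r.
Proof.
move=> r0 rr; rewrite ler_norml => /andP[zl zu].
have a0 : 0 < median_scale k :> R by exact: median_scale_gt0.
(* Here [2 k + 1 < 8 k], as [k >= 1]. *)
have qa : q < median_scale k.
  rewrite ltr_sqrt ?mulr_gt0 ?ltr0n// -addn1 natrD -mul2n natrM.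
  by have : 1 <= k%:R :> R by [rewrite ler1n]; lra.

have hr0 : 0 < h 0 * r / 2 by rewrite divr_gt0 ?mulr_gt0.
have hqa : h 0 * r / 2 * q < median_scale k * (h 0 * r / 2).
  by rewrite mulrC ltr_pM2r.
have near t : `|t - h 0 * r| <= C0 * r ^+ 3 ->
    [/\ 0 <= t <= 2^-1 & h 0 * r / 2 * q < median_scale k * t].
  have xr : `|r| <= rho by rewrite gtr0_norm// ltW.
  have sc := scaled_le xr; rewrite gtr0_norm// in sc.
  move=> /(median_tail_near h0_gt0 k0 (ltW r0) (flat_le xr) sc)[t0 _ tge t4].
  split; first by apply/andP; split => //; lra.
  by apply: lt_le_trans hqa _; rewrite ler_pM2l.
rewrite ler_norml; apply/andP; split.
  rewrite leNgt; apply/negP => /ltW; rewrite quantile_coupling_le sample_median_lower.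
  have [|t01 tq] := near (2^-1 - H (- r)).
    have := @dist_of_density_expansion (- r); rewrite normrN gtr0_norm// => /(_ (ltW rr)).
    by rewrite -normrN; congr (`|_| <= _); ring.
  rewrite -[z]opprK PhiN => /le_trans /(_ (median_tail_le k0 t01)).
  by rewrite leNgt gauss_tail_lt// (le_lt_trans _ tq)//; lra.
rewrite quantile_coupling_le.
have [|t01 tq] := near (H r - 2^-1).
  by have := @dist_of_density_expansion r; rewrite gtr0_norm// => /(_ (ltW rr)).
suff : 1 - G r <= gauss_tail z by rewrite /gauss_tail; lra.
rewrite sample_median_upper (le_trans (median_tail_le k0 t01))//.
by rewrite gauss_tail_le// (le_trans zu)// ltW.
Qed.

End sample.

End density_expansion.

(** * Choice of the constants and conclusion *)

(** Passes from an error cubic in [y] to one cubic in [z]. As half of [y] absorbs the cubic term,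
    [|y| <= 2 |z| + 2 c], and [(u + v)^3 <= 4 (u^3 + v^3)] for nonnegative [u], [v]. *)
Lemma cubic_bootstrap (R : realType) (c m y z : R) : 0 <= c -> 1 <= m ->
  `|y - z| <= c / m * (1 + `|y| ^+ 3) -> c / m * `|y| ^+ 3 <= `|y| / 2 ->
  `|y - z| <= c * (33 + 32 * c ^+ 3) / m * (1 + `|z| ^+ 3).
Proof.
move=> c0 m1 yz y_small; have m0 : 0 < m by lra.
have cm : c / m <= c by rewrite ler_pdivrMr// ler_peMr.
have cm0 : 0 <= c / m by rewrite divr_ge0// ltW.
have y_le : `|y| <= 2 * `|z| + 2 * c.
  have := ler_normD (y - z) z; rewrite subrK; move: yz; rewrite mulrDr mulr1; lra.
have z0 := normr_ge0 z.
have y3 : `|y| ^+ 3 <= 32 * (`|z| ^+ 3 + c ^+ 3).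
  apply: (@le_trans _ _ ((2 * `|z| + 2 * c) ^+ 3)).
    by rewrite lerXn2r ?nnegrE// addr_ge0// mulr_ge0.
  have : 0 <= (`|z| + c) * (`|z| - c) ^+ 2 by rewrite mulr_ge0 ?addr_ge0 ?sqr_ge0.
  by lra.
apply: (le_trans yz); rewrite (_ : c * _ / m = c / m * (33 + 32 * c ^+ 3)); last first.
  by rewrite mulrAC.
rewrite -[leRHS]mulrA; apply: ler_wpM2l => //.

have : 0 <= c ^+ 3 * `|z| ^+ 3 by rewrite mulr_ge0 ?exprn_ge0.
have := exprn_ge0 3 z0; lra.
Qed.

Lemma le_sum4 (R : realDomainType) (b1 b2 b3 b4 : R) :
  0 <= b1 -> 0 <= b2 -> 0 <= b3 -> 0 <= b4 ->
  let b := b1 + b2 + b3 + b4 + 1 in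
  [/\ 0 < b, b1 <= b, b2 <= b, b3 <= b & b4 <= b].
Proof. by move=> ? ? ? ? b; rewrite /b; split; lra. Qed.

Theorem theorem6 (R : realType) (h : R -> R)
    (h_density : is_density h)
    (h_half : (\int[lebesgue_measure]_(x in `]-oo, 0%R]) (h x)%:E
                 = (2^-1 : R)%:E)%E)
    (h0_gt0 : 0 < h 0)
    (h_flat : exists C0 : R,
       \forall x \near (0 : R), `|h x - h 0| <= C0 * x ^+ 2) :
  exists C eps : R, [/\ 0 < C, 0 < eps &
    forall k : nat, (1 <= k)%N ->
    forall (d : measure_display) (T : measurableType d) (P : probability T R)
      (xi : 'I_k.*2.+1 -> {RV P >-> R}), iid_density xi h ->
    let m : R := k.*2.+1%:R in
    let xi_med := sample_median xi in
    let G := dist_fun xi_med in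
    let g := median_pdf k (dist_fun (xi ord0)) h in
    [/\ forall x : R, `|x| <= eps ->
          exists2 theta : R,
            `|theta| <= C * (k%:R * x ^+ 4 + k%:R^-1) &
            g x = Num.sqrt (8 * k%:R) * h 0 / Num.sqrt (2 * pi) *
              expR (- (8 * k%:R * h 0 ^+ 2 * x ^+ 2 / 2) + theta),
        forall x : R, 0 < x -> x < eps ->
          (exists2 theta : R,
            `|theta| <= C * (k%:R * x ^+ 4 + k%:R^-1) &
            G (- x) =
              Phi (- (Num.sqrt (8 * k%:R) * h 0 * x)) * expR theta) /\
          (exists2 theta : R,
            `|theta| <= C * (k%:R * x ^+ 4 + k%:R^-1) &
            1 - G x =
              (1 - Phi (Num.sqrt (8 * k%:R) * h 0 * x)) * expR theta) &
        exists xi_tilde : {mfun R >-> R},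
          forall (d' : measure_display) (T' : measurableType d')
            (P' : probability T' R) (Z : {RV P' >-> R}), is_std_normal Z ->
          eq_law (distribution P' (xi_tilde \o Z)) (distribution P xi_med) /\
          forall w : T',
            let xt := xi_tilde (Z w) in
            (`|xt| <= eps ->
               `|2 * h 0 * Num.sqrt m * xt - Z w| <=
                 C / m + C / m * `|2 * h 0 * Num.sqrt m * xt| ^+ 3) /\
            (`|Z w| <= eps * Num.sqrt m ->
               `|2 * h 0 * Num.sqrt m * xt - Z w| <=
                 C / m * (1 + `|Z w| ^+ 3))]].
Proof.
have [C0' /nbhs_ballP[rho0 /= rho0_gt0 h_ball]] := h_flat.
pose C0 := `|C0'|; have C0_ge0 : 0 <= C0 by exact: normr_ge0.
(* The four terms serve, in order, to stay inside the open ball of flatness, to have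
   [rho ^+ 2 <= rho], and to obtain [rho_C0] and [rho_h0]. *)
pose rho := Num.min (Num.min (rho0 / 2) 1)
  (Num.min (h 0 / (2 * (C0 + 1))) (6 * h 0)^-1).
have rho_gt0 : 0 < rho.
  have C0p : 0 < 2 * (C0 + 1) by rewrite mulr_gt0// ltr_wpDl.
  by rewrite !lt_min (divr_gt0 rho0_gt0)// ltr01 (divr_gt0 h0_gt0)// invr_gt0 mulr_gt0.
have rho_rho0 : rho <= rho0 / 2 by rewrite !ge_min lexx.
have rho1 : rho <= 1 by rewrite !ge_min lexx ?orbT.
have rho_C0 : C0 * rho ^+ 2 <= h 0 / 2.
  have : rho <= h 0 / (2 * (C0 + 1)) by rewrite !ge_min lexx ?orbT.
  rewrite ler_pdivlMr; last by rewrite mulr_gt0 ?ltr_wpDl.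
  have : rho ^+ 2 <= rho by rewrite expr2 ler_piMr// ltW.
  by move=> /(ler_wpM2l C0_ge0); lra.
have rho_h0 : h 0 * rho <= 6^-1.
  have : rho <= (6 * h 0)^-1 by rewrite !ge_min lexx ?orbT.
  by rewrite -(ler_pM2l h0_gt0) invfM mulrCA divff ?gt_eqF// mulr1.
have h_near x : `|x| <= rho -> `|h x - h 0| <= C0 * x ^+ 2.
  move=> xr; apply: le_trans (h_ball x _) _.
    by rewrite /ball/= sub0r normrN; lra.
  by rewrite ler_wpM2r ?sqr_ge0 ?ler_norm.
pose g : R := 2 ^+ 11; have g_ge : 2 ^+ 11 <= g by [].
have g_ge0 : 0 <= g by exact: exprn_ge0.
pose c1 := pdf_error_cst g (h 0) C0.
pose c2 := tail_error_cst g (h 0) C0.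
pose c3 := coupling_cst g (h 0) C0.
have h4 : 0 <= (3 / 2 * h 0) ^+ 4 by exact: exprn_even_ge0.
have h00 := ltW h0_gt0; have ch : 0 <= C0 * h 0 by exact: mulr_ge0.
have h41 : 0 <= 1 + (3 / 2 * h 0) ^+ 4 by exact: addr_ge0.
have c1_ge0 : 0 <= c1.
  apply: addr_ge0; last exact: divr_ge0 (mulr_ge0 (ler0n _ 2) C0_ge0) h00.
  apply: addr_ge0; last exact: mulr_ge0 (ler0n _ 10) ch.
  by apply: addr_ge0 => //; exact: mulr_ge0 (ler0n _ 32) h41.
have c2_ge0 : 0 <= c2.
  apply: addr_ge0; first exact: mulr_ge0 g_ge0 h41.
  apply: addr_ge0; first exact: mulr_ge0 (ler0n _ 8) C0_ge0.
  exact: mulr_ge0 (ler0n _ 10) ch.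
have c3_ge0 : 0 <= c3.
  apply: addr_ge0; first by apply: addr_ge0 => //; exact: mulr_ge0 (ler0n _ 16) g_ge0.
  exact: divr_ge0 C0_ge0 (mulr_ge0 (ler0n _ 4) (exprn_ge0 3 h00)).
pose c4 := c3 * (33 + 32 * c3 ^+ 3).
have c4_ge0 : 0 <= c4.
  by rewrite mulr_ge0// addr_ge0// mulr_ge0// exprn_ge0.
pose C := c1 + c2 + c3 + c4 + 1.
(* The second term makes [4 * c3 * h 0 ^+ 2 * r ^+ 2] at most 1/2, which is the smallness required
   by [cubic_bootstrap]. *)
pose r := Num.min (rho / 2) (1 + 8 * c3 * h 0 ^+ 2)^-1.
have a_ge0 : 0 <= 8 * c3 * h 0 ^+ 2 by rewrite !mulr_ge0// exprn_ge0// ltW.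
have a_gt0 : 0 < 1 + 8 * c3 * h 0 ^+ 2 by rewrite ltr_wpDr.
have r_gt0 : 0 < r by rewrite lt_min divr_gt0 ?invr_gt0.
have r_rho : r < rho by rewrite gt_min ltr_pdivrMr// ltr_pMr// ltr1n.
have r_c3 : 8 * c3 * h 0 ^+ 2 * r ^+ 2 <= 1.
  have : r <= (1 + 8 * c3 * h 0 ^+ 2)^-1 by rewrite !ge_min lexx ?orbT.
  rewrite -div1r ler_pdivlMr// mulrDr mulr1 => ra.
  have : r ^+ 2 <= r by rewrite expr2 ler_piMr ?(ltW r_gt0)// ltW// (lt_le_trans r_rho).
  by move=> /(ler_wpM2l a_ge0); move: ra r_gt0; lra.
(* The second term is the threshold in [quantile_coupling_small]: it turns a bound on [Z] into
   [|xt| <= r]. *)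
pose eps := Num.min r (h 0 * r / 2).
have eps_gt0 : 0 < eps by rewrite lt_min r_gt0 divr_gt0 ?mulr_gt0.
have eps_r : eps <= r by rewrite ge_min lexx.
have eps_h : eps <= h 0 * r / 2 by rewrite ge_min lexx orbT.
have eps_rho : eps <= rho by rewrite (le_trans eps_r)// ltW.
have [C_gt0 C1 C2 C3 C4] := le_sum4 c1_ge0 c2_ge0 c3_ge0 c4_ge0.
exists C, eps; split; [exact: C_gt0|exact: eps_gt0|].
move=> k k1 d T P xi iid.
pose m : R := k.*2.+1%:R; pose xi_med := sample_median xi; pose G := dist_fun xi_med.
have m1 : 1 <= m by rewrite ler1n.
have m0 : 0 < m by exact: lt_le_trans m1.
have weaken (c x : R) : c <= C ->
    c * (k%:R * x ^+ 4 + k%:R^-1) <= C * (k%:R * x ^+ 4 + k%:R^-1).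
  by move=> cC; rewrite ler_wpM2r// addr_ge0 ?invr_ge0// mulr_ge0// exprn_even_ge0.
have coupling x z : `|x| <= rho -> G x = Phi z ->
    `|2 * h 0 * Num.sqrt m * x - z| <= c3 / m * (1 + `|2 * h 0 * Num.sqrt m * x| ^+ 3).
  exact: (sample_median_coupling h_density h_half h0_gt0 C0_ge0 rho_C0 h_near).
split.
- move=> x /le_trans/(_ eps_rho) xr.
  have [theta th_le ->] := sample_median_pdf h_density h_half h0_gt0 C0_ge0 rho_C0
    h_near k1 iid rho_h0 g_ge xr.
  by exists theta => //; apply: le_trans th_le _; exact: weaken.
- move=> x x0 /ltW/le_trans/(_ eps_rho) xr; split.
    have [theta th_le E] := sample_median_lower_tail h_density h_half h0_gt0 C0_ge0
      rho_C0 h_near k1 iid rho_h0 g_ge x0 xr.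
    by exists theta => //; apply: le_trans th_le _; exact: weaken.
  have [theta th_le E] := sample_median_upper_tail h_density h_half h0_gt0 C0_ge0
    rho_C0 h_near k1 iid rho_h0 g_ge x0 xr.
  by exists theta => //; apply: le_trans th_le _; exact: weaken.
exists (quantile_coupling xi_med) => d' T' P' Z Zn; split.
  exact: quantile_coupling_law.
move=> w; pose xt := quantile_coupling xi_med (Z w).
rewrite -/m -/xt; have xt_near : `|xt| <= r -> `|2 * h 0 * Num.sqrt m * xt - Z w| <=
    c3 / m * (1 + `|2 * h 0 * Num.sqrt m * xt| ^+ 3).
  move=> xr; have xr' := le_lt_trans xr r_rho; apply: coupling; first exact: ltW.
  exact: (dist_fun_quantile_coupling h_density h0_gt0 C0_ge0 rho_C0 h_near).
split => [/le_trans/(_ eps_r)/xt_near xt_le|zw].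
  apply: (le_trans xt_le); rewrite mulrDr mulr1.
  have cCm : c3 / m <= C / m by rewrite ler_pM2r ?invr_gt0.
  by rewrite lerD// ler_wpM2r ?exprn_ge0.
have xr : `|xt| <= r.
  apply: (quantile_coupling_small h_density h_half h0_gt0 C0_ge0 rho_C0 h_near k1
    iid rho_h0 r_gt0 r_rho).
  by rewrite (le_trans zw)// ler_wpM2r ?sqrtr_ge0.
apply: (@le_trans _ _ (c4 / m * (1 + `|Z w| ^+ 3))); last first.
  rewrite ler_wpM2r ?addr_ge0 ?exprn_ge0//.
  by rewrite ler_pM2r ?invr_gt0.
apply: cubic_bootstrap (xt_near xr) _ => //.
set y := 2 * h 0 * Num.sqrt m * xt.
have y2 : `|y| ^+ 2 = 4 * h 0 ^+ 2 * m * `|xt| ^+ 2.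
  rewrite !real_normK ?num_real// /y.
  transitivity (4 * h 0 ^+ 2 * Num.sqrt m ^+ 2 * xt ^+ 2); first by ring.
  by rewrite sqr_sqrtr// ltW.
have -> : c3 / m * `|y| ^+ 3 = 4 * c3 * h 0 ^+ 2 * `|xt| ^+ 2 * `|y|.
  by rewrite exprSr y2; field; rewrite gt_eqF.
rewrite mulrC ler_wpM2l//.
have : `|xt| ^+ 2 <= r ^+ 2 by rewrite lerXn2r ?nnegrE// ltW.
by move=> /(ler_wpM2l a_ge0); move: r_c3; lra.
Qed.
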